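(* There is a logarithmic-space reduction from 3-SAT to the following problem: given a finite idempotent algebra $\mathbf{A}$ with finitely many basic operations, given by their tables of values, which lies in a congruence distributive variety, and an element $b\in A$, decide whether $\mathbf{A}$ has a $\{b\}$-blocker. That is, there is a log-space computable map sending each 3-CNF formula $\psi$ to such a pair $(\mathbf{A},b)$ (with $\mathbf{A}$ idempotent and having directed Jónsson terms) such that $\psi$ is satisfiable if and only if $\mathbf{A}$ has a $\{b\}$-blocker.
   Context: $B$-blocker: for a subuniverse $B$ of $\mathbf{A}$, a pair $(C,D)$ of subsets of $A$ such that (1) $D$ is a subuniverse of $\mathbf{A}$; (2) $\emptyset\neq C\subseteq D$; (3) $C\cap B=\emptyset$; (4) $D\cap B\neq\emptyset$; (5) for every $n\ge 1$, $D^n\setminus (D\setminus C)^n$ is a subuniverse of $\mathbf{A}^n$. Directed Jónsson terms: ternary terms $d_0,\dots,d_n$ with $d_0(x,y,z)=x$, $d_n(x,y,z)=z$, $d_i(x,y,y)=d_{i+1}(x,x,y)$ for $i<n$, and $d_i(x,y,x)=x$ for all $i$; a finite algebra has such terms iff it lies in a congruence distributive variety. An algebra is idempotent if every basic operation $f$ satisfies $f(x,\dots,x)\approx x$. *)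

(* Defs.v *)
From Stdlib Require List.
From mathcomp Require Import all_boot.
Set Implicit Arguments. Unset Strict Implicit. Unset Printing Implicit Defensive.

(* Universe {0,...,acard-1}; each basic operation is a pair (arity k, table)
   where the table lists f(a_1,...,a_k) at index sum a_i * acard^(k-i)
   (lexicographic order, a_1 most significant). *)
Record alg := Alg { acard : nat; ops : seq (nat * seq nat) }.

Definition tindex (A : alg) (args : seq nat) : nat :=
  foldl (fun acc a => acc * acard A + a) 0 args.

Definition app (A : alg) (o : nat * seq nat) (args : seq nat) : nat :=
  nth 0 o.2 (tindex A args).

Definition wf_alg (A : alg) : Prop :=
  0 < acard A /\
  forall o, o \in ops A ->
    size o.2 = acard A ^ o.1 /\ all (fun v => v < acard A) o.2.

Definition idempotent_alg (A : alg) : Prop :=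
  forall o, o \in ops A -> forall a, a < acard A -> app A o (nseq o.1 a) = a.

Definition subuniverse (A : alg) (D : pred nat) : Prop :=
  (forall x, D x -> x < acard A) /\
  forall o, o \in ops A -> forall args : seq nat,
    size args = o.1 -> all D args -> D (app A o args).

Definition subuniverse_pow (A : alg) (n : nat) (S : pred (seq nat)) : Prop :=
  (forall t, S t -> size t = n /\ all (fun v => v < acard A) t) /\
  forall o, o \in ops A -> forall ts : seq (seq nat),
    size ts = o.1 -> all S ts ->
    S [seq app A o [seq nth 0 t j | t <- ts] | j <- iota 0 n].

Definition blocker (A : alg) (b : nat) (C D : pred nat) : Prop :=
  [/\ subuniverse A D,
      (exists c, C c) /\ (forall x, C x -> D x),
      ~~ C b,
      D b &
      forall n, 0 < n ->
        subuniverse_pow A n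
          (fun t => (size t == n) && all D t && has C t)].
(* D^n \ (D \ C)^n = n-tuples over D having some coordinate in C *)

Definition has_blocker (A : alg) (b : nat) : Prop :=
  exists C D : pred nat, blocker A b C D.

Inductive term3 (A : alg) : (nat -> nat -> nat -> nat) -> Prop :=
| T_proj (i : nat) : i < 3 -> term3 A (fun x y z => nth 0 [:: x; y; z] i)
| T_app (o : nat * seq nat) (gs : seq (nat -> nat -> nat -> nat)) :
    o \in ops A -> size gs = o.1 ->
    (forall g, List.In g gs -> term3 A g) ->
    term3 A (fun x y z => app A o [seq g x y z | g <- gs]).

Definition directed_jonsson (A : alg) : Prop :=
  exists ds : seq (nat -> nat -> nat -> nat),
    0 < size ds /\ (forall g, List.In g ds -> term3 A g) /\
    let n := (size ds).-1 in
    let d i := nth (fun x _ _ => x) ds i in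
    forall x y z, x < acard A -> y < acard A -> z < acard A ->
      [/\ d 0 x y z = x, d n x y z = z,
          forall i, i < n -> d i x y y = d i.+1 x x y &
          forall i, i <= n -> d i x y x = x].

(* literal (true, i) = x_i, (false, i) = not x_i *)
Definition formula := seq (seq (bool * nat)).

Definition is3CNF (psi : formula) : Prop := all (fun cl => size cl == 3) psi.

Definition satisfiable (psi : formula) : Prop :=
  exists v : nat -> bool, all (fun cl => has (fun l => v l.2 == l.1) cl) psi.

(* (0,1 = bits, 2 and 3 = separators)                                  *)

Fixpoint bin_aux (fuel n : nat) : seq nat :=
  match fuel with
  | 0 => [::]
  | f.+1 => if n == 0 then [::] else rcons (bin_aux f n./2) (n %% 2)
  end.
(* binary, most significant bit first, no leading zeros (0 is empty) *)
Definition bin (n : nat) : seq nat := bin_aux n n.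

Definition enc_formula (psi : formula) : seq nat :=
  flatten [seq flatten [seq (nat_of_bool l.1 :: bin l.2) ++ [:: 2] | l <- cl]
               ++ [:: 3] | cl <- psi].

Definition enc_instance (Ab : alg * nat) : seq nat :=
  bin (acard Ab.1) ++ [:: 3] ++ bin Ab.2 ++ [:: 3] ++
  flatten [seq bin o.1 ++ [:: 2] ++ flatten [seq bin e ++ [:: 2] | e <- o.2]
               ++ [:: 3] | o <- ops Ab.1].

(* Deterministic Turing machine with a read-only two-way input tape
   (input symbols 0..3, endmarker 4 on both sides), one read/write work tape
   over {0,...,W-1} (0 = blank, infinite to the right), and a write-only
   one-way output tape over {0,..,3}. *)
Inductive dir := DL | DS | DR.

Record ltm := LTM {
  nstates : nat; nwork : nat; qstart : nat; qhalt : nat;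
  trans : nat -> nat -> nat -> nat * nat * dir * dir * option nat }.

Definition valid_ltm (M : ltm) : Prop :=
  [/\ qstart M < nstates M, qhalt M < nstates M, 0 < nwork M &
      forall q a s, q < nstates M -> a <= 4 -> s < nwork M ->
        let: (q', s', _, _, o) := trans M q a s in
        [/\ q' < nstates M, s' < nwork M &
            match o with None => True | Some v => v < 4 end]].

Record config := Config {
  cst : nat; cih : nat; cwt : nat -> nat; cwh : nat; cout : seq nat }.

Definition init_config (M : ltm) : config :=
  Config (qstart M) 0 (fun _ => 0) 0 [::].

Definition step (M : ltm) (x : seq nat) (c : config) : config :=
  if cst c == qhalt M then c else
  let n := size x in
  let a := if (cih c == 0) || (n < cih c) then 4 else nth 0 x (cih c).-1 in
  let: (q', s', di, dw, o) := trans M (cst c) a (cwt c (cwh c)) in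
  let ih' := match di with
             | DL => (cih c).-1 | DS => cih c | DR => minn (cih c).+1 n.+1 end in
  let wh' := match dw with
             | DL => (cwh c).-1 | DS => cwh c | DR => (cwh c).+1 end in
  let wt' := fun j => if j == cwh c then s' else cwt c j in
  let out' := match o with None => cout c | Some v => rcons (cout c) v end in
  Config q' ih' wt' wh' out'.

Definition run (M : ltm) (x : seq nat) (t : nat) : config :=
  iter t (step M x) (init_config M).

Definition computes_logspace (M : ltm) (c : nat) (x y : seq nat) : Prop :=
  (exists t, cst (run M x t) = qhalt M /\ cout (run M x t) = y) /\
  forall t, cwh (run M x t) <= c * trunc_log 2 (size x + 2) + c.

Definition logspace_computable {X Y : Type} (encX : X -> seq nat)
    (encY : Y -> seq nat) (P : X -> Prop) (f : X -> Y) : Prop :=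
  exists (M : ltm) (c : nat), valid_ltm M /\
    forall x, P x -> computes_logspace M c (encX x) (encY (f x)).

(* Main.v *)
(* Write [n] for the length of the encoding [x] of a formula.  The algebra lives
   on the positions of [x] plus two elements, [b] and a bottom [bot]; the element
   [q] stands for the literal occurrence that follows position [q].
   Condition (5) on a blocker [(C, D)] says that every basic operation preserves
   [C] along one of its coordinates, so each operation expresses a disjunction:
   - [val_jonsson] has only its first coordinate available, which puts [bot] in
     [C]; with its mirror image it also forms a directed Jonsson chain;
   - for a clause with occurrences [q1, q2, q3], the values [q1, q2, q3] at
     [(bot, b, b)], [(b, bot, b)], [(b, b, bot)] put one of them in [C];
   - for complementary occurrences [p, q], the value [b] at [(p, b, _)] and
     [(b, q, _)] keeps one of them out of [C].
   So the blockers amount to the consistent choices of a literal in each clause.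
   For the logarithmic space bound, the instance is written as the value of a
   comprehension whose variables are bounded by [n + 3] and whose conditions are
   bounded first-order formulas about [x].  Any such comprehension is evaluated
   by a machine that keeps one binary counter per variable on its work tape. *)
Require Import Defs.
From mathcomp Require Import all_boot zify.
From Stdlib Require Import FunctionalExtensionality.
Set Implicit Arguments. Unset Strict Implicit. Unset Printing Implicit Defensive.

(** * Machines over finite types *)

(** [GInstance] never has more than nine variables in scope, so twelve registers are enough. *)
Definition reg := 'I_12.
Definition col := {ffun reg -> bool}.
(** [None] is the blank and [Some None] the mark of the left end; any other cell holds one bit of
    every register, so the registers share the tape in parallel. *)
Definition wsym : finType := option (option col).
Definition marker : wsym := Some None.
Definition column (c : col) : wsym := Some (Some c).

Record tconf := TConf {
  tih : nat; ttape : nat -> wsym; twh : nat; tout : seq nat }.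

Definition action : Type := wsym * dir * dir * option nat.

(** A transition leads to a state or leaves the machine with a boolean; this exit value is what
    branches and loops test. *)
Record mach := Mach {
  mQ : finType; mstart : mQ;
  mtrans : mQ -> nat -> wsym -> (mQ + bool) * action }.

Definition sym (x : seq nat) (h : nat) : nat :=
  if (h == 0) || (size x < h) then 4 else nth 0 x h.-1.

Definition move_in (n : nat) (d : dir) (h : nat) : nat :=
  match d with DL => h.-1 | DS => h | DR => minn h.+1 n.+1 end.

Definition move_work (d : dir) (h : nat) : nat :=
  match d with DL => h.-1 | DS => h | DR => h.+1 end.

(** Reduction modulo 4 keeps the output inside the alphabet, as [valid_ltm] requires. *)
Definition act (x : seq nat) (c : tconf) (a : action) : tconf :=
  let: (w, di, dw, o) := a in
  TConf (move_in (size x) di (tih c))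
        (fun j => if j == twh c then w else ttape c j)
        (move_work dw (twh c))
        (if o is Some v then rcons (tout c) (v %% 4) else tout c).

Definition fire (x : seq nat) (M : mach) (q : mQ M) (c : tconf) :=
  mtrans q (sym x (tih c)) (ttape c (twh c)).
Arguments fire x M q c : clear implicits.

(** The work head is bounded by [s] in every configuration that fires a transition; the final one is
    bounded separately in [mrun_iter]. *)
Inductive mrun (x : seq nat) (s : nat) (M : mach) :
    mQ M -> tconf -> bool -> tconf -> Prop :=
| Mexit q c b a : twh c <= s -> fire x M q c = (inr b, a) ->
    mrun x s q c b (act x c a)
| Mstep q c q' a b c' : twh c <= s -> fire x M q c = (inl q', a) ->
    mrun x s q' (act x c a) b c' -> mrun x s q c b c'.
Arguments mrun x s M q c b c' : clear implicits.

Section ToLtm.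
Variable M : mach.

Definition encS (q : option (mQ M)) : nat := enum_rank q.
(** The blank must become 0, which fills the initial work tape of the machine model. *)
Definition encW (w : wsym) : nat := if w is Some u then (enum_rank u).+1 else 0.
Definition decW (s : nat) : wsym :=
  if s is s'.+1 then Some (nth None (enum {: option col}) s') else None.

Definition ltm_of : ltm :=
  LTM #|{: option (mQ M)}| #|{: option col}|.+1 (encS (Some (mstart M))) (encS None)
    (fun q a s =>
      if nth None (enum {: option (mQ M)}) q is Some p then
        let: (p', (w, di, dw, o)) := mtrans p a (decW s) in
        (encS (if p' is inl p'' then Some p'' else None), encW w, di, dw,
         omap (modn^~ 4) o)
      else (q, s, DS, DS, None)).

Lemma encSK q : nth None (enum {: option (mQ M)}) (encS q) = q.
Proof. exact: nth_enum_rank. Qed.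

Lemma encWK w : decW (encW w) = w.
Proof. by case: w => [u|] //=; rewrite nth_enum_rank. Qed.

Lemma encS_lt q : encS q < #|{: option (mQ M)}|.
Proof. exact: ltn_ord. Qed.

Lemma encW_lt w : encW w < #|{: option col}|.+1.
Proof. by case: w => [u|] //=; rewrite ltnS ltn_ord. Qed.

Lemma ltm_of_valid : valid_ltm ltm_of.
Proof.
split; rewrite ?encS_lt // => q a s hq _ hs; rewrite /trans /=.
case: (nth _ _ q) => [p|] //; case: (mtrans _ _ _) => p' [[[w di] dw] o].
by split; [exact: encS_lt | exact: encW_lt | case: o => //= v; rewrite ltn_mod].
Qed.

Definition conf_of (q : option (mQ M)) (c : tconf) : config :=
  Config (encS q) (tih c) (fun j => encW (ttape c j)) (twh c) (tout c).

Lemma encS_halt q : (encS (Some q) == encS None) = false.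
Proof. by apply/eqP => h; have := encSK (Some q); rewrite h encSK. Qed.

Lemma step_conf_of x q c p a : fire x M q c = (p, a) ->
  step ltm_of x (conf_of (Some q) c)
    = conf_of (if p is inl q' then Some q' else None) (act x c a).
Proof.
rewrite /fire /sym => hf; rewrite /step {1}/conf_of [qhalt _]/= [cst _]/= encS_halt.
rewrite [trans _ _ _ _]/= encSK encWK hf.
case: a {hf} => [[[w di] dw] o]; rewrite /conf_of /=; congr Config.
- by apply: functional_extensionality => j; case: eqP.
- by case: o.
Qed.

Lemma step_halt x c : step ltm_of x (conf_of None c) = conf_of None c.
Proof. by rewrite /step /= eqxx. Qed.

Lemma mrun_iter x s q c b c' : mrun x s M q c b c' -> twh c' <= s ->
  (exists t, iter t (step ltm_of x) (conf_of (Some q) c) = conf_of None c')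
  /\ forall t, cwh (iter t (step ltm_of x) (conf_of (Some q) c)) <= s.
Proof.
elim=> {q c b c'} [q c b a hs hf hs'|q c q' a b c' hs hf _ IH hs'].
  split; first by exists 1; rewrite /= (step_conf_of hf).
  case=> [//|t]; rewrite iterSr (step_conf_of hf).
  (* A halted configuration is fixed by [step], which extends the bound on the head to all later
     times. *)
  have -> // : iter t (step ltm_of x) (conf_of None (act x c a))
    = conf_of None (act x c a) by elim: t => //= t ->; rewrite step_halt.
have [[t ht] hb] := IH hs'; split.
  by exists t.+1; rewrite iterSr (step_conf_of hf).
by case=> [//|u]; rewrite iterSr (step_conf_of hf).
Qed.

End ToLtm.

(** * Branches and loops of machines *)

Definition mIf (M1 M2 M3 : mach) : mach :=
  @Mach (mQ M1 + (mQ M2 + mQ M3))%type (inl (mstart M1)) (fun q a w =>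
    match q with
    | inl q1 => let: (p, u) := mtrans q1 a w in
        (inl (match p with
              | inl q1' => inl q1'
              | inr true => inr (inl (mstart M2))
              | inr false => inr (inr (mstart M3)) end), u)
    | inr (inl q2) => let: (p, u) := mtrans q2 a w in
        (match p with inl q' => inl (inr (inl q')) | inr b => inr b end, u)
    | inr (inr q3) => let: (p, u) := mtrans q3 a w in
        (match p with inl q' => inl (inr (inr q')) | inr b => inr b end, u)
    end).

Definition mWhile (M1 M2 : mach) : mach :=
  @Mach (mQ M1 + mQ M2)%type (inl (mstart M1)) (fun q a w =>
    match q with
    | inl q1 => let: (p, u) := mtrans q1 a w in
        (match p with
         | inl q1' => inl (inl q1')
         | inr true => inl (inr (mstart M2))
         | inr false => inr false end, u)
    | inr q2 => let: (p, u) := mtrans q2 a w in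
        (inl (match p with inl q' => inr q' | inr _ => inl (mstart M1) end), u)
    end).

Section Combinators.
Variables (x : seq nat) (s : nat).

Lemma mrun_mIf M1 M2 M3 q c (b1 : bool) c1 b c2 :
  mrun x s M1 q c b1 c1 ->
  (if b1 then mrun x s M2 (mstart M2) c1 b c2
         else mrun x s M3 (mstart M3) c1 b c2) ->
  mrun x s (mIf M1 M2 M3) (inl q) c b c2.
Proof.
have lift2 q2 d b' d' : mrun x s M2 q2 d b' d' ->
    mrun x s (mIf M1 M2 M3) (inr (inl q2)) d b' d'.
  elim=> {q2 d b' d'} [q2 d b' a hs hf|q2 d q' a b' d' hs hf _ IH].
    by apply: Mexit => //; move: hf; rewrite /fire /= => ->.
  by apply: (@Mstep x s (mIf M1 M2 M3) _ _ (inr (inl q')) _ _ _ hs _ IH);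
    move: hf; rewrite /fire /= => ->.
have lift3 q3 d b' d' : mrun x s M3 q3 d b' d' ->
    mrun x s (mIf M1 M2 M3) (inr (inr q3)) d b' d'.
  elim=> {q3 d b' d'} [q3 d b' a hs hf|q3 d q' a b' d' hs hf _ IH].
    by apply: Mexit => //; move: hf; rewrite /fire /= => ->.
  by apply: (@Mstep x s (mIf M1 M2 M3) _ _ (inr (inr q')) _ _ _ hs _ IH);
    move: hf; rewrite /fire /= => ->.
elim=> {q c b1 c1} [q c [] a hs hf|q c q' a b1 c1 hs hf _ IH] h2.
- apply: (@Mstep x s (mIf M1 M2 M3) _ _ (inr (inl (mstart M2))) _ _ _ hs _ (lift2 _ _ _ _ h2)).
  by move: hf; rewrite /fire /= => ->.
- apply: (@Mstep x s (mIf M1 M2 M3) _ _ (inr (inr (mstart M3))) _ _ _ hs _ (lift3 _ _ _ _ h2)).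
  by move: hf; rewrite /fire /= => ->.
by apply: (@Mstep x s (mIf M1 M2 M3) _ _ (inl q') _ _ _ hs _ (IH h2));
  move: hf; rewrite /fire /= => ->.
Qed.

Lemma mrun_mWhile_false M1 M2 q c c1 :
  mrun x s M1 q c false c1 -> mrun x s (mWhile M1 M2) (inl q) c false c1.
Proof.
move=> h; move eb: false h => b1 h.
elim: h eb => {q c b1 c1} [q c b1 a hs hf|q c q' a b1 c1 hs hf _ IH] hb.
  by apply: Mexit => //; move: hf; rewrite /fire /= => ->; rewrite -hb.
by apply: (@Mstep x s (mWhile M1 M2) _ _ (inl q') _ _ _ hs _ (IH hb));
  move: hf; rewrite /fire /= => ->.
Qed.

Lemma mrun_mWhile_true M1 M2 q c c1 b2 c2 c3 :
  mrun x s M1 q c true c1 -> mrun x s M2 (mstart M2) c1 b2 c2 ->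
  mrun x s (mWhile M1 M2) (inl (mstart M1)) c2 false c3 ->
  mrun x s (mWhile M1 M2) (inl q) c false c3.
Proof.
move=> h1 h2 h3; move eb: true h1 => b1 h1.
have lift2 : mrun x s (mWhile M1 M2) (inr (mstart M2)) c1 false c3.
  elim: h2 h3 => {b2 c1 c2 h1} [q2 d b' a hs hf|q2 d q' a b' d' hs hf _ IH] h3.
    by apply: (@Mstep x s (mWhile M1 M2) _ _ (inl (mstart M1)) _ _ _ hs _ h3);
      move: hf; rewrite /fire /= => ->.
  by apply: (@Mstep x s (mWhile M1 M2) _ _ (inr q') _ _ _ hs _ (IH h3));
    move: hf; rewrite /fire /= => ->.
elim: h1 eb lift2 => {q c b1 c1 h2} [q c b1 a hs hf|q c q' a b1 c1 hs hf _ IH] hb l2.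
  apply: (@Mstep x s (mWhile M1 M2) _ _ (inr (mstart M2)) _ _ _ hs _ l2);
    move: hf; rewrite /fire /= => ->.
  by rewrite -hb.
by apply: (@Mstep x s (mWhile M1 M2) _ _ (inl q') _ _ _ hs _ (IH hb l2));
  move: hf; rewrite /fire /= => ->.
Qed.

End Combinators.

(** * Atomic machines and round trips over the work tape *)

Definition mAtom (f : pred nat) (d : dir) (o : option nat) : mach :=
  @Mach unit tt (fun _ a w => (inr (f a), (w, d, DS, o))).

Definition mMark : mach :=
  @Mach unit tt (fun _ _ _ => (inr true, (marker, DS, DS, None))).

Definition tape_of (cs : seq col) (j : nat) : wsym :=
  if j is j'.+1 then nth None (map column cs) j' else marker.

(** A round trip from the left mark to the first blank and back. Columns stand least significant
    first, so carries travel on the way out, and the way back meets the most significant digits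
    first, as printing requires. *)
Definition mSweep (s0 : bool) (fR : bool -> col -> bool * col)
    (fE : bool -> option col) (fL : bool -> col -> bool * option bool) : mach :=
  @Mach (option (bool * bool)) None (fun q _ w =>
    match q, w with
    | None, _ => (inl (Some (true, s0)), (w, DS, DR, None))
    | Some (true, s), Some (Some c) =>
        (inl (Some (true, (fR s c).1)), (column (fR s c).2, DS, DR, None))
    | Some (true, s), _ =>
        (inl (Some (false, s)), (omap Some (fE s), DS, DL, None))
    | Some (false, s), Some (Some c) =>
        (inl (Some (false, (fL s c).1)),
         (w, DS, DL, omap nat_of_bool (fL s c).2))
    | Some (false, s), _ => (inr s, (w, DS, DS, None))
    end).

Fixpoint right_pass (fR : bool -> col -> bool * col) s cs : bool * seq col :=
  if cs is c :: cs' then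
    let: (s', cs1) := right_pass fR (fR s c).1 cs' in (s', (fR s c).2 :: cs1)
  else (s, [::]).

Fixpoint left_pass (fL : bool -> col -> bool * option bool) s rcs
    : bool * seq nat :=
  if rcs is c :: rcs' then
    let: (s', out) := left_pass fL (fL s c).1 rcs' in
    (s', seq_of_opt (omap nat_of_bool (fL s c).2) ++ out)
  else (s, [::]).

Lemma tape_of_update cs c tl d :
  (fun j => if j == (size cs).+1 then column d else tape_of (cs ++ c :: tl) j)
  = tape_of (rcons cs d ++ tl).
Proof.
apply: functional_extensionality => -[|j] //=; rewrite eqSS !map_cat map_rcons /=.
rewrite !nth_cat size_rcons size_map nth_rcons size_map.
case: ltngtP => h; rewrite ?ltnS.
- by rewrite ltnW.
- by rewrite leqNgt h /= -[j - size cs]prednK ?subn_gt0 // subnS.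
- by rewrite -h leqnn.
Qed.

Lemma tape_of_read cs c tl : tape_of (cs ++ c :: tl) (size cs).+1 = column c.
Proof. by rewrite /= map_cat nth_cat size_map ltnn subnn. Qed.

Lemma tape_of_end cs : tape_of cs (size cs).+1 = None.
Proof. by rewrite /= nth_default ?size_map. Qed.

Lemma tape_of_same cs j :
  (fun i => if i == j then tape_of cs j else tape_of cs i) = tape_of cs.
Proof. by apply: functional_extensionality => i; case: eqP => [->|]. Qed.

Lemma tape_of_write_end cs o :
  (fun j => if j == (size cs).+1 then omap Some o else tape_of cs j)
  = tape_of (cs ++ seq_of_opt o).
Proof.
apply: functional_extensionality => -[|j] //=; rewrite eqSS map_cat nth_cat size_map.
case: ltngtP => h.
- by [].
- rewrite nth_default ?size_map ?(ltnW h) //; case: o => [c|] /=; rewrite ?nth_nil //.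
  by rewrite -[j - _]prednK ?subn_gt0 //= nth_nil.
- by rewrite h subnn; case: o.
Qed.

Section Sweep.
Variables (x : seq nat) (S : nat) (s0 : bool).
Variables (fR : bool -> col -> bool * col).
Variables (fE : bool -> option col) (fL : bool -> col -> bool * option bool).
Let M := mSweep s0 fR fE fL.

(** The head stands on the last column of [ds], and [tl] collects the columns already crossed; hence
    the induction from the right end. *)
Lemma run_left_pass ih s ds tl out : size ds <= S ->
  mrun x S M (Some (false, s)) (TConf ih (tape_of (ds ++ tl)) (size ds) out)
    (left_pass fL s (rev ds)).1
    (TConf ih (tape_of (ds ++ tl)) 0 (out ++ (left_pass fL s (rev ds)).2)).
Proof.
elim/last_ind: ds s tl out => [|ds c IH] s tl out hs.
  have := @Mexit x S M (Some (false, s)) (TConf ih (tape_of tl) 0 out)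
    s (marker, DS, DS, None) erefl erefl.
  by rewrite /act /= cats0 (tape_of_same tl 0).
rewrite size_rcons in hs *; rewrite rev_rcons cat_rcons.
set st := left_pass _ _ _.
have -> : st = let: (s', o) := left_pass fL (fL s c).1 (rev ds) in
  (s', seq_of_opt (omap nat_of_bool (fL s c).2) ++ o) by [].
case E: (left_pass fL (fL s c).1 (rev ds)) => [s' o].
apply: (@Mstep x S M _ _ (Some (false, (fL s c).1))
  (column c, DS, DL, omap nat_of_bool (fL s c).2)) => //.
  by rewrite /fire [ttape _ _]tape_of_read.
have hs' : size ds <= S by exact: ltnW.
have := IH (fL s c).1 (c :: tl)
  (out ++ seq_of_opt (omap nat_of_bool (fL s c).2)) hs'.
rewrite E -catA /act /= -[column c](tape_of_read ds c tl) tape_of_same.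
by case: (fL s c).2 => [[]|] /=; rewrite ?cats0 ?cats1.
Qed.

Lemma run_right_pass ih s ds cs out b c' : size (ds ++ cs) < S ->
  mrun x S M (Some (true, (right_pass fR s cs).1))
    (TConf ih (tape_of (ds ++ (right_pass fR s cs).2)) (size (ds ++ cs)).+1 out) b c' ->
  mrun x S M (Some (true, s)) (TConf ih (tape_of (ds ++ cs)) (size ds).+1 out) b c'.
Proof.
elim: cs s ds => [|c cs IH] s ds /= hs; rewrite ?cats0 //.
case E: (right_pass fR (fR s c).1 cs) => [s' cs'] /= h.
apply: (@Mstep x S M _ _ (Some (true, (fR s c).1)) (column (fR s c).2, DS, DR, None)).
- by move: hs; rewrite size_cat /=; lia.
- by rewrite /fire [ttape _ _]tape_of_read.
rewrite /act /= tape_of_update -(size_rcons ds (fR s c).2); apply: IH.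
  by move: hs; rewrite !size_cat size_rcons addSnnS.
by move: h; rewrite E !cat_rcons !size_cat.
Qed.

(** The head reaches cell [(size cs).+1], hence the strict bound. A column appended at the turn lies
    to the right of the head on the way back, so [left_pass] runs over [cs1] alone. *)
Lemma run_sweep ih cs out : size cs < S ->
  let: (s1, cs1) := right_pass fR s0 cs in
  let: (s2, o) := left_pass fL s1 (rev cs1) in
  mrun x S M (mstart M) (TConf ih (tape_of cs) 0 out) s2
    (TConf ih (tape_of (cs1 ++ seq_of_opt (fE s1))) 0 (out ++ o)).
Proof.
move=> hs; case E: (right_pass fR s0 cs) => [s1 cs1].
case E' : (left_pass fL s1 (rev cs1)) => [s2 o].
have hsz : size cs1 = size cs.
  elim: cs s0 s1 cs1 E {hs E'} => [|c cs IH] s s1 cs1 /=; first by case=> _ <-.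
  by case F: (right_pass _ _ _) => [u v] [_ <-] /=; rewrite (IH _ _ _ F).
apply: (@Mstep x S M None _ (Some (true, s0)) (marker, DS, DR, None)) => //.
rewrite /act /= -[marker]/(tape_of cs 0) tape_of_same.
apply: (@run_right_pass ih s0 [::] cs) => //=; rewrite E /=.
apply: (@Mstep x S M _ _ (Some (false, s1)) (omap Some (fE s1), DS, DL, None)) => //.
  by rewrite /fire -hsz [ttape _ _]tape_of_end.
rewrite /act /= -hsz tape_of_write_end.
have := @run_left_pass ih s1 cs1 (seq_of_opt (fE s1)) out; rewrite E' /=.
by apply; rewrite hsz ltnW.
Qed.

End Sweep.

(** * Binary counters *)

Definition regs := {ffun reg -> nat}.

Definition upd (e : regs) (r : reg) (v : nat) : regs :=
  [ffun r' => if r' == r then v else e r'].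

Definition halve (e : regs) : regs := [ffun r => (e r)./2].

(* Binary digits, least significant column first. *)
Fixpoint cols (e : regs) (l : nat) : seq col :=
  if l is l'.+1 then [ffun r => odd (e r)] :: cols (halve e) l' else [::].

Definition set_bit (c : col) (r : reg) (b : bool) : col :=
  [ffun r' => if r' == r then b else c r'].

Definition silent (s : bool) (c : col) : bool * option bool := (s, None).
Definition no_ext (s : bool) : option col := None.

Definition mSkip : mach := mAtom predT DS None.
Definition mConst (b : bool) : mach := mAtom (fun _ => b) DS None.
Definition mSeq (M1 M2 : mach) : mach := mIf M1 M2 M2.

(** Ripple carry, started with carry 1; a carry that survives all columns goes into a new column, in
    which the other registers have digit 0. *)
Definition mInc (r : reg) : mach :=
  mSweep true (fun s c => (s && c r, set_bit c r (c r (+) s)))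
    (fun s => if s then Some [ffun r' => r' == r] else None) silent.
Definition mZero (r : reg) : mach :=
  mSweep true (fun s c => (s, set_bit c r false)) no_ext silent.
Definition mNeq (r r' : reg) : mach :=
  mSweep false (fun s c => (s || (c r != c r'), c)) no_ext silent.
(** The state records whether a nonzero digit has been met, so that leading zeros are suppressed as
    in [bin]. *)
Definition mPrint (r : reg) : mach :=
  mSweep false (fun s c => (s, c)) no_ext
    (fun s c => (s || c r, if s || c r then Some (c r) else None)).

Lemma size_cols e l : size (cols e l) = l.
Proof. by elim: l e => //= l IH e; rewrite IH. Qed.

Lemma left_pass_silent s rcs : left_pass silent s rcs = (s, [::]).
Proof. by elim: rcs => //= c rcs ->. Qed.

Lemma left_pass_rcons fL s rcs c : left_pass fL s (rcons rcs c) =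
  (let: (s1, o1) := left_pass fL s rcs in
   ((fL s1 c).1, o1 ++ seq_of_opt (omap nat_of_bool (fL s1 c).2))).
Proof.
elim: rcs s => [|c' rcs IH] s /=; first by rewrite cats0.
by rewrite IH; case: (left_pass fL _ rcs) => s1 o1; rewrite catA.
Qed.

Lemma half_lt_exp m l : (m./2 < 2 ^ l) = (m < 2 ^ l.+1).
Proof. by rewrite expnS; lia. Qed.

Lemma halve_bound (e : regs) l :
  (forall r, e r < 2 ^ l.+1) -> forall r, halve e r < 2 ^ l.
Proof. by move=> h r; rewrite ffunE half_lt_exp. Qed.

Lemma halve_upd e r v : halve (upd e r v) = upd (halve e) r v./2.
Proof. by apply/ffunP => r'; rewrite !ffunE; case: eqP. Qed.

(** The inequality under [s] says that a new column appears only on overflow; it later keeps the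
    number of columns within the space bound. *)
Lemma right_pass_inc (r : reg) l (e : regs) : (forall r', e r' < 2 ^ l) ->
  let: (s, cs) :=
    right_pass (fun s c => (s && c r, set_bit c r (c r (+) s))) true (cols e l) in
  cs ++ seq_of_opt (if s then Some [ffun r' => r' == r] else None)
    = cols (upd e r (e r).+1) (l + s)
  /\ (s -> 2 ^ l <= (e r).+1) /\ forall r', upd e r (e r).+1 r' < 2 ^ (l + s).
Proof.
elim: l e => [|l IH] e he.
  have e0 r' : e r' = 0 by move: (he r'); rewrite expn0; case: (e r').
  split; last by split=> // r'; rewrite ffunE !e0; case: eqP.
  by congr cons; apply/ffunP => r'; rewrite !ffunE !e0; case: eqP.
have hup : odd (e r) -> halve (upd e r (e r).+1) = upd (halve e) r (halve e r).+1.
  by move=> ho; rewrite halve_upd; apply/ffunP => r'; rewrite !ffunE; case: eqP => //; lia.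
have hup0 : ~~ odd (e r) -> halve (upd e r (e r).+1) = halve e.
  move=> ho; rewrite halve_upd; apply/ffunP => r'; rewrite !ffunE; case: eqP => // ->.
  by lia.
have hc : set_bit [ffun r' => odd (e r')] r ([ffun r' => odd (e r')] r (+) true)
    = [ffun r' => odd (upd e r (e r).+1 r')] :> col.
  by apply/ffunP => r'; rewrite !ffunE; case: eqP => // _; rewrite addbT.
rewrite /= hc ffunE /=; case ho: (odd (e r)) => /=; last first.
  (* Once the carry is gone, the pass copies the remaining columns. *)
  have -> cs : right_pass (fun s c => (s && c r, set_bit c r (c r (+) s))) false cs
      = (false, cs).
    elim: cs => //= c cs ->; congr (_, _ :: _); apply/ffunP => r'; rewrite !ffunE addbF.
    by case: eqP => [->|].
  rewrite addn0 cats0 /= hup0 ?ho //; split=> //; split=> // r'; rewrite addn0 ffunE.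
  by case: eqP => // _; have := he r; rewrite expnS; lia.
have := IH _ (halve_bound he).
case: (right_pass _ _ _) => s cs [h1 [h0 h2]]; rewrite addSn /= hup // -h1.
split=> //; split=> [/h0|r'].
  by rewrite ffunE expnS; lia.
by rewrite -half_lt_exp; have := h2 r'; rewrite -hup // ffunE.
Qed.

Lemma right_pass_zero (r : reg) l (e : regs) :
  right_pass (fun s c => (s, set_bit c r false)) true (cols e l)
  = (true, cols (upd e r 0) l).
Proof.
elim: l e => //= l IH e; rewrite IH halve_upd; congr (_, _ :: _).
by apply/ffunP => r'; rewrite !ffunE; case: eqP.
Qed.

Lemma right_pass_neq (r r' : reg) l (e : regs) s : (forall r, e r < 2 ^ l) ->
  right_pass (fun s c => (s || (c r != c r'), c)) s (cols e l)
  = (s || (e r != e r'), cols e l).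
Proof.
elim: l e s => [|l IH] e s he.
  by move: (he r) (he r'); rewrite expn0; case: (e r) => //; case: (e r') => //=; rewrite orbF.
rewrite /= IH; last exact: halve_bound.
rewrite !ffunE -orbA; congr (_ || _, _).
by apply/idP/idP; [case/orP|]; lia.
Qed.

Lemma right_pass_id cs : right_pass (fun s c => (s, c)) false cs = (false, cs).
Proof. by elim: cs => //= c cs ->. Qed.

Lemma bin_aux_fuel f n : n <= f -> bin_aux f n = bin n.
Proof.
rewrite /bin; have [m] := ubnP n; elim: m f n => // m IH [|f] [|n] //=; rewrite !ltnS => hm hf.
have hu : uphalf n <= n by lia.
by rewrite !(IH _ (uphalf n)) // (leq_ltn_trans hu, leq_trans hu).
Qed.

Lemma bin_half n : 0 < n -> bin n = rcons (bin n./2) (odd n).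
Proof.
by case: n => // n _; rewrite {1}/bin /= bin_aux_fuel ?modn2 //=; lia.
Qed.

(** The induction removes the least significant column, which is read last; the exit state of the
    columns before it tells whether a higher digit was nonzero. *)
Lemma left_pass_print (r : reg) l (e : regs) : (forall r, e r < 2 ^ l) ->
  left_pass (fun s c => (s || c r, if s || c r then Some (c r) else None))
    false (rev (cols e l)) = (0 < e r, bin (e r)).
Proof.
elim: l e => [|l IH] e he.
  by move: (he r); rewrite expn0; case: (e r).
rewrite /= rev_cons left_pass_rcons IH; last exact: halve_bound.
have -> : (0 < halve e r) || [ffun r => odd (e r)] r = (0 < e r).
  by rewrite !ffunE; apply/orP/idP => [[]|]; lia.
rewrite !ffunE; case h: (0 < e r); first by rewrite [in RHS]bin_half //= cats1.
by case: (e r) h.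
Qed.

(** * Bounded comprehensions *)

Definition mRight : mach := mAtom predT DR None.
Definition mLeft : mach := mAtom predT DL None.
(** The first move leaves the right endmarker, where the loop would stop at once; at the left
    endmarker it has no effect. *)
Definition mHome : mach :=
  mSeq mLeft (mWhile (mAtom (fun a => a != 4) DS None) mLeft).

Definition mFor (v d : nat) (body : mach) : mach :=
  mSeq (mZero (inord d))
    (mWhile (mNeq (inord d) (inord v)) (mSeq body (mInc (inord d)))).

(* Variables are de Bruijn levels: [BEx v e] and [GFor v g] bind the next level
   to every value below that of the variable [v]. *)
Inductive bexp :=
| BConst of bool
| BNeq of nat & nat
| BSym of seq nat & nat & pred nat
| BIf of bexp & bexp & bexp
| BEx of nat & bexp.

Inductive gen :=
| GNil
| GOut of nat
| GPrint of nat
| GSeq of gen & gen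
| GIf of bexp & gen & gen
| GFor of nat & gen.

(** The conditions [d < 12] stand where the compiled code takes register [d], as the bound variable
    or, for [BSym], as a scratch counter. *)
Fixpoint bscoped (d : nat) (e : bexp) : bool :=
  match e with
  | BConst _ => true
  | BNeq v w => (v < d) && (w < d)
  | BSym vs _ _ => all (fun v => v < d) vs && (d < 12)
  | BIf e1 e2 e3 => [&& bscoped d e1, bscoped d e2 & bscoped d e3]
  | BEx v e => [&& v < d, d < 12 & bscoped d.+1 e]
  end.

Fixpoint gscoped (d : nat) (g : gen) : bool :=
  match g with
  | GNil => true
  | GOut _ => true
  | GPrint v => v < d
  | GSeq g1 g2 => gscoped d g1 && gscoped d g2
  | GIf e g1 g2 => [&& bscoped d e, gscoped d g1 & gscoped d g2]
  | GFor v g => [&& v < d, d < 12 & gscoped d.+1 g]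
  end.

Fixpoint bsem (x env : seq nat) (e : bexp) : bool :=
  match e with
  | BConst b => b
  | BNeq v w => nth 0 env v != nth 0 env w
  | BSym vs k f => f (sym x (sumn [seq nth 0 env v | v <- vs] + k))
  | BIf e1 e2 e3 => if bsem x env e1 then bsem x env e2 else bsem x env e3
  | BEx v e => has (fun i => bsem x (rcons env i) e) (iota 0 (nth 0 env v))
  end.

Fixpoint gsem (x env : seq nat) (g : gen) : seq nat :=
  match g with
  | GNil => [::]
  | GOut s => [:: s %% 4]
  | GPrint v => bin (nth 0 env v)
  | GSeq g1 g2 => gsem x env g1 ++ gsem x env g2
  | GIf e g1 g2 => if bsem x env e then gsem x env g1 else gsem x env g2
  | GFor v g => flatten [seq gsem x (rcons env i) g | i <- iota 0 (nth 0 env v)]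
  end.

(** [BSym] sends the input head home and counts it forward by each variable in turn. [BEx] stops its
    counter at the first witness, so a witness exists exactly when the counter ends different from
    the bound. *)
Fixpoint bcomp (d : nat) (e : bexp) : mach :=
  match e with
  | BConst b => mConst b
  | BNeq v w => mNeq (inord v) (inord w)
  | BSym vs k f => mSeq mHome (foldr (fun v => mSeq (mFor v d mRight))
                     (iter k (mSeq mRight) (mAtom f DS None)) vs)
  | BIf e1 e2 e3 => mIf (bcomp d e1) (bcomp d e2) (bcomp d e3)
  | BEx v e => mSeq (mZero (inord d))
      (mSeq (mWhile (mIf (mNeq (inord d) (inord v))
                       (mIf (bcomp d.+1 e) (mConst false) (mConst true))
                       (mConst false))
                    (mInc (inord d)))
            (mNeq (inord d) (inord v)))
  end.

Fixpoint gcomp (d : nat) (g : gen) : mach :=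
  match g with
  | GNil => mSkip
  | GOut s => mAtom predT DS (Some s)
  | GPrint v => mPrint (inord v)
  | GSeq g1 g2 => mSeq (gcomp d g1) (gcomp d g2)
  | GIf e g1 g2 => mIf (bcomp d e) (gcomp d g1) (gcomp d g2)
  | GFor v g => mFor v d (gcomp d.+1 g)
  end.

(** * Correctness of the compiled machines *)

Section Spec.
Variables (x : seq nat) (lmax : nat).
Hypothesis lmaxP : size x + 3 < 2 ^ lmax.
Hypothesis x_small : all (fun a => a < 4) x.
Local Notation run := (mrun x lmax.+1).

(** Only the registers of variables in scope have prescribed values; the others may hold leftovers,
    as long as these fit into the [l] columns. *)
Definition good (env : seq nat) (ih : nat) (out : seq nat) (c : tconf) : Prop :=
  exists (e : regs) (l : nat),
    [/\ l <= lmax, forall r, e r < 2 ^ l,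
        size env <= 12 /\ (forall v, v < size env -> e (inord v) = nth 0 env v) &
        c = TConf ih (tape_of (cols e l)) 0 out].

Definition spec (M : mach) env ih out (P : pred bool) env' ih' out' : Prop :=
  forall c, good env ih out c ->
  exists b c', [/\ P b, good env' ih' out' c' & run M (mstart M) c b c'].

Lemma spec_any M env ih out P env' ih' out' :
  spec M env ih out P env' ih' out' -> spec M env ih out predT env' ih' out'.
Proof. by move=> h c /h [b [c' [_ h1 h2]]]; exists b, c'. Qed.

Lemma spec_atom f d o env ih out :
  spec (mAtom f d o) env ih out (pred1 (f (sym x ih)))
    env (move_in (size x) d ih) (out ++ seq_of_opt (omap (modn^~ 4) o)).
Proof.
move=> c [e [l [h1 h2 h3 ->]]].
exists (f (sym x ih)), (TConf (move_in (size x) d ih) (tape_of (cols e l)) 0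
  (out ++ seq_of_opt (omap (modn^~ 4) o))); split=> /=; first exact: eqxx.
  by exists e, l.
have := @Mexit x lmax.+1 (mAtom f d o) tt (TConf ih (tape_of (cols e l)) 0 out)
  _ _ erefl erefl.
rewrite /act /= (tape_of_same (cols e l) 0).
by case: o => [v|] /=; rewrite ?cats1 ?cats0.
Qed.

Lemma spec_if M1 M2 M3 env ih out (b : bool) env1 ih1 out1 P env2 ih2 out2 :
  spec M1 env ih out (pred1 b) env1 ih1 out1 ->
  spec (if b then M2 else M3) env1 ih1 out1 P env2 ih2 out2 ->
  spec (mIf M1 M2 M3) env ih out P env2 ih2 out2.
Proof.
move=> h1 h2 c /h1 [b1 [c1 [/eqP eb g1 r1]]]; rewrite {b1}eb in r1.
have [b2 [c2 [hb g2 r2]]] := h2 _ g1; exists b2, c2; split=> //.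
by apply: mrun_mIf r1 _; move: r2; case: (b).
Qed.

Lemma spec_seq M1 M2 env ih out env1 ih1 out1 P env2 ih2 out2 :
  spec M1 env ih out predT env1 ih1 out1 ->
  spec M2 env1 ih1 out1 P env2 ih2 out2 ->
  spec (mSeq M1 M2) env ih out P env2 ih2 out2.
Proof.
move=> h1 h2 c /h1 [b1 [c1 [_ g1 r1]]].
have [b2 [c2 [hb g2 r2]]] := h2 _ g1; exists b2, c2; split=> //.
by apply: mrun_mIf r1 _; case: b1.
Qed.

Lemma spec_while_false M1 M2 env ih out env1 ih1 out1 :
  spec M1 env ih out (pred1 false) env1 ih1 out1 ->
  spec (mWhile M1 M2) env ih out (pred1 false) env1 ih1 out1.
Proof.
move=> h1 c /h1 [b1 [c1 [/eqP -> g1 r1]]]; exists false, c1; split=> //.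
exact: mrun_mWhile_false.
Qed.

Lemma spec_while_true M1 M2 env ih out env1 ih1 out1 env2 ih2 out2 P env3 ih3 out3 :
  spec M1 env ih out (pred1 true) env1 ih1 out1 ->
  spec M2 env1 ih1 out1 P env2 ih2 out2 ->
  spec (mWhile M1 M2) env2 ih2 out2 (pred1 false) env3 ih3 out3 ->
  spec (mWhile M1 M2) env ih out (pred1 false) env3 ih3 out3.
Proof.
move=> h1 h2 h3 c /h1 [b1 [c1 [/eqP -> g1 r1]]].
have [b2 [c2 [_ g2 r2]]] := h2 _ g1.
have [b3 [c3 [/eqP h g3 r3]]] := h3 _ g2; rewrite {b3}h in r3.
exists false, c3; split=> //.
exact: mrun_mWhile_true r1 r2 r3.
Qed.

Lemma inord_eq v w : v < 12 -> w < 12 -> (inord v == inord w :> reg) = (v == w).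
Proof. by move=> hv hw; rewrite -val_eqE /= !inordK. Qed.

Lemma spec_zero env ih out : size env < 12 ->
  spec (mZero (inord (size env))) env ih out (pred1 true) (rcons env 0) ih out.
Proof.
move=> hs c [e [l [h1 h2 [h3 h3'] ->]]].
have := @run_sweep x lmax.+1 true (fun s c => (s, set_bit c (inord (size env)) false))
  no_ext silent ih (cols e l) out.
rewrite size_cols ltnS h1 => /(_ isT); rewrite right_pass_zero left_pass_silent !cats0.
move=> hr; eexists; eexists; split; last exact: hr.
  by [].
exists (upd e (inord (size env)) 0), l; split=> //.
- by move=> r; rewrite ffunE; case: eqP; rewrite ?expn_gt0.
- rewrite size_rcons; split=> // v; rewrite ltnS nth_rcons_default ffunE => hv.
  rewrite inord_eq ?(leq_ltn_trans hv hs) //.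
  case: eqP => [->|hne]; first by rewrite nth_default.
  by rewrite h3' // ltn_neqAle hv andbT; apply/eqP.
Qed.

Lemma spec_inc env i ih out : i < size x + 3 ->
  spec (mInc (inord (size env))) (rcons env i) ih out predT (rcons env i.+1) ih out.
Proof.
move=> hi c [e [l [h1 h2 []]]]; rewrite size_rcons => h3 h3' ->.
set r : reg := inord (size env).
have her : e r = i by rewrite /r h3' ?nth_rcons ?ltnn ?eqxx.
have := right_pass_inc r h2.
have := @run_sweep x lmax.+1 true (fun s c => (s && c r, set_bit c r (c r (+) s)))
  (fun s => if s then Some [ffun r' => r' == r] else None) silent ih (cols e l) out.
rewrite size_cols ltnS h1 => /(_ isT).
case E: (right_pass _ _ _) => [s cs]; rewrite left_pass_silent cats0 => hr [hcs [hc hb]].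
rewrite hcs in hr; eexists; eexists; split; last exact: hr.
  by [].
exists (upd e r (e r).+1), (l + s); split=> //.
(* An overflow with all [lmax] columns in use would give [2 ^ lmax <= i.+1], against [lmaxP]. *)
- case: (s) (h1) hc => [|_ _]; last by rewrite addn0.
  rewrite addn1 leq_eqVlt => /orP[/eqP -> /(_ isT)|//].
  by move: lmaxP hi; rewrite her; lia.
- rewrite size_rcons; split=> // v; rewrite ltnS nth_rcons ffunE => hv.
  rewrite inord_eq ?(leq_ltn_trans hv h3) //.
  move: hv; rewrite leq_eqVlt => /orP[/eqP ->|hv]; first by rewrite ltnn !eqxx her.
  by rewrite hv (ltn_eqF hv) h3' ?size_rcons ?nth_rcons ?hv // ltnW.
Qed.

Lemma spec_neq v w env ih out : v < size env -> w < size env ->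
  spec (mNeq (inord v) (inord w)) env ih out (pred1 (nth 0 env v != nth 0 env w))
    env ih out.
Proof.
move=> hv hw c [e [l [h1 h2 [h3 h3'] ->]]].
have := @run_sweep x lmax.+1 false
  (fun s c => (s || (c (inord v) != c (inord w)), c)) no_ext silent ih (cols e l) out.
rewrite size_cols ltnS h1 => /(_ isT); rewrite right_pass_neq // left_pass_silent !cats0.
move=> hr; eexists; eexists; split; last exact: hr.
  by rewrite /= !h3'.
by exists e, l.
Qed.

Lemma spec_print v env ih out : v < size env ->
  spec (mPrint (inord v)) env ih out predT env ih (out ++ bin (nth 0 env v)).
Proof.
move=> hv c [e [l [h1 h2 [h3 h3'] ->]]].
have := @run_sweep x lmax.+1 false (fun s c => (s, c)) no_ext
  (fun s c => (s || c (inord v), if s || c (inord v) then Some (c (inord v)) else None))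
  ih (cols e l) out.
rewrite size_cols ltnS h1 => /(_ isT); rewrite right_pass_id left_pass_print // !cats0.
move=> hr; eexists; eexists; split; last exact: hr.
  by [].
by exists e, l; split; rewrite ?h3'.
Qed.

(** Leaving a scope costs no step: the register of the last variable becomes a leftover. *)
Lemma spec_forget M env ih out P env' i ih' out' :
  spec M env ih out P (rcons env' i) ih' out' -> spec M env ih out P env' ih' out'.
Proof.
move=> h c /h [b [c' [hb [e [l []]]]]]; rewrite size_rcons => h1 h2 [h3 h3'] -> hr.
eexists; eexists; split; [exact: hb| |exact: hr].
exists e, l; split=> //.
by split=> [|v hv]; [exact: ltnW | rewrite h3' ?nth_rcons ?hv // ltnW].
Qed.


(** The invariant [I] ties the counter to the input head and the output. The final head position is
    existential because a body may leave the head anywhere. *)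
Lemma spec_loop (I : nat -> nat -> seq nat -> Prop) env v body ih out :
  v < size env -> size env < 12 -> nth 0 env v <= size x + 3 -> I 0 ih out ->
  (forall i ih out, i < nth 0 env v -> I i ih out ->
    exists ih' out', I i.+1 ih' out'
      /\ spec body (rcons env i) ih out predT (rcons env i) ih' out') ->
  exists ih' out', I (nth 0 env v) ih' out'
    /\ spec (mFor v (size env) body) env ih out predT
         (rcons env (nth 0 env v)) ih' out'.
Proof.
move=> hv hs hm I0 hbody; set m := nth 0 env v in hm hbody *.
have loop k i ih1 out1 : i + k = m -> I i ih1 out1 -> exists ih' out', I m ih' out'
    /\ spec (mWhile (mNeq (inord (size env)) (inord v))
               (mSeq body (mInc (inord (size env)))))
         (rcons env i) ih1 out1 (pred1 false) (rcons env m) ih' out'.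
  elim: k i ih1 out1 => [|k IH] i ih1 out1 hik hI.
    move: hik; rewrite addn0 => hik; rewrite hik in hI *; exists ih1, out1; split=> //.
    apply: spec_while_false; have := @spec_neq (size env) v (rcons env m) ih1 out1.
    rewrite size_rcons !nth_rcons ltnn eqxx hv -/m eqxx; apply=> //.
    exact: ltnW.
  have him : i < m by lia.
  have [ih2 [out2 [hI2 h2]]] := hbody _ _ _ him hI.
  have [|ih3 [out3 [hI3 h3]]] := IH i.+1 ih2 out2 _ hI2; first by lia.
  exists ih3, out3; split=> //.
  apply: spec_while_true h3.
    have := @spec_neq (size env) v (rcons env i) ih1 out1.
    rewrite size_rcons !nth_rcons ltnn eqxx hv -/m (ltn_eqF him); apply=> //.
    exact: ltnW.
  by apply: spec_seq h2 _; apply: spec_inc; apply: leq_trans him hm.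
have [ih' [out' [hI h]]] := loop m 0 ih out erefl I0.
exists ih', out'; split=> //.
by apply: spec_seq (spec_any (@spec_zero _ _ _ _)) (spec_any h).
Qed.

(** The head stops at the right endmarker, but every position beyond the word reads as an endmarker
    too, so stopping does not falsify the symbol read. *)
Lemma sym_minn h : sym x (minn h (size x).+1) = sym x h.
Proof.
rewrite /sym; case: (leqP h (size x).+1) => // hlt.
by rewrite /= ltnSn (ltnW hlt) orbT.
Qed.

Lemma spec_right env h out : spec mRight env (minn h (size x).+1) out predT
  env (minn h.+1 (size x).+1) out.
Proof.
have -> : minn h.+1 (size x).+1 = minn (minn h (size x).+1).+1 (size x).+1 by lia.
by have := spec_any (@spec_atom predT DR None env (minn h (size x).+1) out);
  rewrite /= cats0.
Qed.

Lemma spec_const b env ih out : spec (mConst b) env ih out (pred1 b) env ih out.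
Proof. by have := @spec_atom (fun=> b) DS None env ih out; rewrite /= cats0. Qed.

Lemma spec_test f env ih out :
  spec (mAtom f DS None) env ih out (pred1 (f (sym x ih))) env ih out.
Proof. by have := @spec_atom f DS None env ih out; rewrite /= cats0. Qed.

Lemma spec_left env ih out : spec mLeft env ih out predT env ih.-1 out.
Proof. by have := spec_any (@spec_atom predT DL None env ih out); rewrite /= cats0. Qed.

Lemma spec_home env ih out : ih <= (size x).+1 ->
  spec mHome env ih out predT env 0 out.
Proof.
have loop k : k <= size x -> spec (mWhile (mAtom (fun a => a != 4) DS None) mLeft)
    env k out (pred1 false) env 0 out.
  elim: k => [|k IH] hk; have := @spec_test (fun a => a != 4) env _ out.
    by move/(_ 0); rewrite eqxx; apply: spec_while_false.
  move/(_ k.+1); have -> : sym x k.+1 != 4.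
    by rewrite /sym /= ltnNge hk /= neq_ltn (allP x_small) // mem_nth.
  by move=> h; apply: spec_while_true h (@spec_left _ _ _) (IH (ltnW hk)).
move=> hih; apply: spec_seq (@spec_left _ _ _) (spec_any (loop _ _)).
by lia.
Qed.

Lemma spec_seek f k env h out :
  spec (iter k (mSeq mRight) (mAtom f DS None)) env (minn h (size x).+1) out
    (pred1 (f (sym x (h + k)))) env (minn (h + k) (size x).+1) out.
Proof.
elim: k h => [|k IH] h.
  by rewrite addn0 -sym_minn; apply: spec_test.
by rewrite -addSnnS; apply: spec_seq (@spec_right _ _ _) (IH _).
Qed.

Lemma bcomp_spec e env ih out : bscoped (size env) e -> size env <= 12 ->
  all (fun a => a <= size x + 3) env -> ih <= (size x).+1 ->
  exists2 ih', ih' <= (size x).+1 &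
    spec (bcomp (size env) e) env ih out (pred1 (bsem x env e)) env ih' out.
Proof.
elim: e env ih => [b|v w|vs k f|e1 IH1 e2 IH2 e3 IH3|v e IH] env ih /= hsc hs henv hih.
- by exists ih => //; apply: spec_const.
- by case/andP: hsc => hv hw; exists ih => //; apply: spec_neq.
- case/andP: hsc => hvs hs'.
  exists (minn (sumn [seq nth 0 env v | v <- vs] + k) (size x).+1); first exact: geq_minr.
  apply: spec_seq (@spec_home _ _ _ hih) _.
  (* The starting position [h] is general because it grows as the variables are added one by one. *)
  suff seek us h : all (fun v => v < size env) us ->
      spec (foldr (fun v => mSeq (mFor v (size env) mRight))
              (iter k (mSeq mRight) (mAtom f DS None)) us)
        env (minn h (size x).+1) out
        (pred1 (f (sym x (h + sumn [seq nth 0 env v | v <- us] + k)))) env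
        (minn (h + sumn [seq nth 0 env v | v <- us] + k) (size x).+1) out.
    by have := seek vs 0 hvs; rewrite min0n add0n.
  elim: us h => [|v us IH] h /=; first by rewrite addn0 => _; apply: spec_seek.
  case/andP=> hv /(IH (h + nth 0 env v)) {}IH.
  rewrite addnA; apply: spec_seq _ IH.
  have [|||ih' [out' [[-> ->]]]] := @spec_loop
    (fun i ih' out' => ih' = minn (h + i) (size x).+1 /\ out' = out)
    env v mRight (minn h (size x).+1) out hv hs'.
  + by apply: (allP henv); rewrite mem_nth.
  + by rewrite addn0.
  + move=> i _ _ _ [-> ->]; exists (minn (h + i.+1) (size x).+1), out; split=> //.
    by rewrite addnS; apply: spec_right.
  exact: spec_forget.
- case/and3P: hsc => h1 h2 h3.
  have [ih1 hi1 s1] := IH1 _ _ h1 hs henv hih.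
  case: (bsem x env e1) s1 => s1.
    by have [ih2 hi2 s2] := IH2 _ _ h2 hs henv hi1; exists ih2 => //; apply: spec_if s1 _.
  by have [ih2 hi2 s2] := IH3 _ _ h3 hs henv hi1; exists ih2 => //; apply: spec_if s1 _.
case/and3P: hsc => hv hd hsc; set m := nth 0 env v.
have hm : m <= size x + 3 by apply: (allP henv); rewrite mem_nth.
have sneq i ih1 : spec (mNeq (inord (size env)) (inord v)) (rcons env i) ih1 out
    (pred1 (i != m)) (rcons env i) ih1 out.
  have := @spec_neq (size env) v (rcons env i) ih1 out.
  rewrite size_rcons !nth_rcons ltnn eqxx hv -/m; apply=> //.
  exact: ltnW.
(* [j] is the value at which the loop stops: the first witness from [i] on, or the bound [m]. *)
have loop k i ih1 : i + k = m -> ih1 <= (size x).+1 ->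
    exists j ih2, [/\ ih2 <= (size x).+1,
      (j != m) = has (fun i => bsem x (rcons env i) e) (iota i k) &
      spec (mWhile (mIf (mNeq (inord (size env)) (inord v))
             (mIf (bcomp (size env).+1 e) (mConst false) (mConst true)) (mConst false))
           (mInc (inord (size env))))
         (rcons env i) ih1 out (pred1 false) (rcons env j) ih2 out].
  elim: k i ih1 => [|k IHk] i ih1 hik hi1.
    exists i, ih1; split=> //; first by rewrite -hik addn0 eqxx.
    apply: spec_while_false; apply: spec_if (sneq _ _) _.
    by rewrite -hik addn0 eqxx; apply: spec_const.
  have him : i < m by lia.
  have [] := IH (rcons env i) ih1; rewrite ?size_rcons ?all_rcons ?henv ?andbT //.
    by apply: leq_trans (ltnW him) hm.
  move=> ih2 hi2; case hb: (bsem x (rcons env i) e) => hbody.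
    exists i, ih2; split=> //=; first by rewrite hb (ltn_eqF him).
    apply: spec_while_false; apply: spec_if (sneq _ _) _.
    rewrite (ltn_eqF him); apply: spec_if hbody _; exact: spec_const.
  have [|j [ih3 [hi3 hj h3]]] := IHk i.+1 ih2 _ hi2; first by lia.
  exists j, ih3; split=> //=; first by rewrite hb.
  apply: spec_while_true _ (@spec_inc _ _ _ _ _) h3; last exact: leq_trans him hm.
  apply: spec_if (sneq _ _) _.
  by rewrite (ltn_eqF him); apply: spec_if hbody _; exact: spec_const.
have [j [ih2 [hi2 <- h2]]] := loop m 0 ih erefl hih.
exists ih2 => //; apply: spec_seq (spec_any (@spec_zero _ _ _ hd)) _.
apply: spec_seq (spec_any h2) _; apply: spec_forget; exact: sneq.
Qed.

Lemma gcomp_spec g env ih out : gscoped (size env) g -> size env <= 12 ->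
  all (fun a => a <= size x + 3) env -> ih <= (size x).+1 ->
  exists2 ih', ih' <= (size x).+1 &
    spec (gcomp (size env) g) env ih out predT env ih' (out ++ gsem x env g).
Proof.
elim: g env ih out => [|s|v|g1 IH1 g2 IH2|e g1 IH1 g2 IH2|v g IH] env ih out /=
  hsc hs henv hih.
- exists ih => //; rewrite cats0; exact: spec_any (@spec_const true _ _ _).
- by exists ih => //; have := spec_any (@spec_atom predT DS (Some s) env ih out).
- by exists ih => //; apply: spec_print.
- case/andP: hsc => h1 h2.
  have [ih1 hi1 s1] := IH1 _ _ out h1 hs henv hih.
  have [ih2 hi2 s2] := IH2 _ _ (out ++ gsem x env g1) h2 hs henv hi1.
  by exists ih2 => //; rewrite catA; apply: spec_seq s1 s2.
- case/and3P: hsc => he h1 h2.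
  have [ih1 hi1 s1] := bcomp_spec out he hs henv hih.
  case: (bsem x env e) s1 => s1.
    have [ih2 hi2 s2] := IH1 _ _ out h1 hs henv hi1.
    by exists ih2 => //; apply: spec_if s1 _.
  have [ih2 hi2 s2] := IH2 _ _ out h2 hs henv hi1.
  by exists ih2 => //; apply: spec_if s1 _.
case/and3P: hsc => hv hd hsc.
have hm : nth 0 env v <= size x + 3 by apply: (allP henv); rewrite mem_nth.
have [||ih' [out' [[hih' ->] h]]] := @spec_loop
  (fun i ih' out' => ih' <= (size x).+1 /\
     out' = out ++ flatten [seq gsem x (rcons env i) g | i <- iota 0 i])
  env v (gcomp (size env).+1 g) ih out hv hd hm.
- by rewrite cats0.
- move=> i ih1 _ hi [hi1 ->].
  have [] := IH (rcons env i) ih1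
    (out ++ flatten [seq gsem x (rcons env j) g | j <- iota 0 i]);
    rewrite ?size_rcons ?all_rcons ?henv ?andbT //.
    exact: leq_trans (ltnW hi) hm.
  move=> ih2 hi2 h2; eexists; eexists; split; last exact: h2.
  by rewrite -catA -[i.+1]addn1 iotaD map_cat flatten_cat /= cats0.
by exists ih' => //; apply: spec_forget h.
Qed.

(** * Initial registers and the space bound *)

Definition main_prefix : seq mach :=
  [:: mMark; mZero (inord 0); mRight; mInc (inord 0);
      mWhile (mAtom (fun a => a != 4) DS None) (mSeq mRight (mInc (inord 0)));
      mFor 0 1 mSkip; mInc (inord 1); mFor 1 2 mSkip; mInc (inord 2)].

Definition mMain (g : gen) : mach := foldr mSeq (gcomp 3 g) main_prefix.

Lemma spec_copy v env ih out :
  v < size env -> size env < 12 -> nth 0 env v <= size x + 3 ->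
  spec (mFor v (size env) mSkip) env ih out predT (rcons env (nth 0 env v)) ih out.
Proof.
move=> hv hs hm.
have [//||ih' [out' [[-> ->]]]] := @spec_loop
    (fun _ ih' out' => ih' = ih /\ out' = out) env v mSkip ih out hv hs hm.
- move=> i _ _ _ [-> ->]; exists ih, out; split=> //.
  exact: spec_any (@spec_const true _ _ _).
by [].
Qed.

(** Register 0 counts the cells up to the right endmarker. A [mFor] with empty body copies a
    register, because its counter stops at the bound; copying and incrementing fills registers 1 and
    2. *)
Lemma spec_main g : gscoped 3 g -> exists ih',
  spec (foldr mSeq (gcomp 3 g) (behead (main_prefix)))
    [::] 0 [::] predT [:: (size x).+1; (size x).+2; (size x).+3] ih'
    (gsem x [:: (size x).+1; (size x).+2; (size x).+3] g).
Proof.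
move=> hg; pose n := size x.
have [|||ih' _ hgen] := @gcomp_spec g [:: n.+1; n.+2; n.+3] n.+1 [::] hg => //.
  by rewrite /= -/n; lia.
(* Register 0 and the input head advance together from 1 to the right endmarker at [n.+1]. *)
have count k i : 0 < i -> i + k = n.+1 ->
    spec (mWhile (mAtom (fun a => a != 4) DS None) (mSeq mRight (mInc (inord 0))))
      [:: i] i [::] (pred1 false) [:: n.+1] n.+1 [::].
  elim: k i => [|k IH] i hi hik; have h := @spec_test (fun a => a != 4) [:: i] i [::].
    move: hik h; rewrite addn0 => ->; rewrite /sym ltnSn orbT eqxx.
    exact: spec_while_false.
  have hin : i <= n by lia.
  move: h; have -> : sym x i != 4.
    rewrite /sym ltnNge hin -[i == 0]negbK -lt0n hi /= neq_ltn (allP x_small) //.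
    by rewrite mem_nth // prednK.
  move=> h; apply: spec_while_true h _ (IH i.+1 _ _) => //; last by lia.
  apply: spec_seq; last by apply: (@spec_inc [::] i); lia.
  have := @spec_right [:: i] i [::].
  by rewrite (minn_idPl _) 1?(minn_idPl _) //; exact: leqW.
exists ih'.
apply: spec_seq (spec_any (@spec_zero [::] 0 [::] isT)) _.
apply: spec_seq (@spec_right [:: 0] 0 [::]) _; rewrite (minn_idPl _) //.
apply: spec_seq (@spec_inc [::] 0 1 [::] _) _; first by lia.
apply: spec_seq (spec_any (count n 1 _ _)) _ => //.
apply: spec_seq (@spec_copy 0 [:: n.+1] n.+1 [::] _ _ _) _ => //; first by rewrite /= -/n; lia.
apply: spec_seq (@spec_inc [:: n.+1] n.+1 n.+1 [::] _) _; first by lia.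
apply: spec_seq (@spec_copy 1 [:: n.+1; n.+2] n.+1 [::] _ _ _) _ => //.
  by rewrite /= -/n; lia.
apply: spec_seq (@spec_inc [:: n.+1; n.+2] n.+2 n.+1 [::] _) hgen.
by lia.
Qed.

Lemma mMain_run g : gscoped 3 g ->
  exists b c, [/\ twh c = 0,
    tout c = gsem x [:: (size x).+1; (size x).+2; (size x).+3] g &
    run (mMain g) (mstart (mMain g)) (TConf 0 (fun _ => None) 0 [::]) b c].
Proof.
move=> /spec_main [ih' h].
have [|b [c [_ [e [l [_ _ _ ->]]] hr]]] := h (TConf 0 (tape_of [::]) 0 [::]).
  exists [ffun=> 0], 0; split=> // r; by rewrite ffunE.
exists b; eexists; split; last first.
(* [mMark] turns the blank tape into [tape_of [::]], the form assumed by [spec]. *)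
- apply: (@mrun_mIf _ _ mMark _ _ _ _ true); last exact: hr.
  have := @Mexit x lmax.+1 mMark tt (TConf 0 (fun _ => None) 0 [::]) _ _ erefl erefl.
  rewrite /act /=; congr (mrun _ _ _ _ _ _ (TConf _ _ _ _)).
  by apply: functional_extensionality => -[|j] //=; rewrite nth_nil.
- by [].
- by [].
Qed.

End Spec.

Theorem gen_logspace (g : gen) : gscoped 3 g ->
  exists (M : ltm) (c : nat), valid_ltm M /\
    forall x, all (fun a => a < 4) x ->
      computes_logspace M c x (gsem x [:: (size x).+1; (size x).+2; (size x).+3] g).
Proof.
(* With [lmax = k + 2] the work head stays at positions up to [k + 3], which is at most
   [3 * k + 3]. *)
move=> hg; exists (ltm_of (mMain g)), 3; split; first exact: ltm_of_valid.
move=> x hx; set k := trunc_log 2 (size x + 2).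
have hk : size x + 3 < 2 ^ (k + 2).
  have := @trunc_log_ltn 2 (size x + 2) isT; rewrite -/k (addn2 k) !expnS; lia.
have [b [c [h0 hout hr]]] := mMain_run hk hx hg.
have [|[t ht] hb] := mrun_iter hr; first by rewrite h0.
split.
  by exists t; rewrite /run [iter _ _ _]ht.
by move=> u; apply: leq_trans (hb u) _; lia.
Qed.

(** * Operation tables and conditions on positions *)

Definition upto {T : Type} (n : nat) (F : nat -> seq T) : seq T :=
  flatten [seq F i | i <- iota 0 n].

Lemma uptoP (T : eqType) n (F : nat -> seq T) y :
  reflect (exists2 i, i < n & y \in F i) (y \in upto n F).
Proof.
apply: (iffP flatten_mapP) => -[i hi hy]; exists i => //.
  by move: hi; rewrite mem_iota.
by rewrite mem_iota.
Qed.

Lemma uptoS T n (F : nat -> seq T) : upto n.+1 F = upto n F ++ F n.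
Proof. by rewrite /upto -addn1 iotaD map_cat flatten_cat /= cats0. Qed.

Lemma size_upto T n m (F : nat -> seq T) :
  (forall i, i < n -> size (F i) = m) -> size (upto n F) = n * m.
Proof.
elim: n => // n IH h; rewrite uptoS size_cat h // IH ?mulSn ?[m + _]addnC // => i hi.
by apply: h; apply: ltnW.
Qed.

Lemma nth_upto T (x0 : T) n m (F : nat -> seq T) i r :
  (forall i, i < n -> size (F i) = m) -> i < n -> r < m ->
  nth x0 (upto n F) (i * m + r) = nth x0 (F i) r.
Proof.
elim: n => // n IH h hi hr.
have h' j : j < n -> size (F j) = m by move=> hj; apply: h; apply: ltnW.
rewrite uptoS nth_cat (size_upto h').
move: hi; rewrite ltnS leq_eqVlt => /orP[/eqP ->|hi].
  by rewrite ltnNge leq_addr /= addKn.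
by rewrite (leq_trans (_ : _ < i.+1 * m)) ?leq_mul2r ?hi ?orbT ?IH // mulSn addnC ltn_add2r.
Qed.

(** Tables and operation lists are built from [upto], the list form of a [GFor] loop, so that a
    comprehension can produce them. The nesting gives the lexicographic order of [tindex]. *)
Definition table (n : nat) (val : nat -> nat -> nat -> nat) : seq nat :=
  upto n (fun a => upto n (fun b => upto n (fun c => [:: val a b c]))).

Definition op3 n val : nat * seq nat := (3, table n val).

Lemma size_table n val : size (table n val) = n ^ 3.
Proof.
rewrite !expnS expn0; apply: size_upto => a _; apply: size_upto => b _.
exact: size_upto.
Qed.

Lemma app_op3 A n val a b c : acard A = n -> a < n -> b < n -> c < n ->
  app A (op3 n val) [:: a; b; c] = val a b c.
Proof.
move=> hA ha hb hc; rewrite /app /tindex /= hA mul0n add0n.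
(* The index splits along blocks of lengths [n * n], [n] and 1, one for each nested [upto]. *)
have -> : (a * n + b) * n + c = a * (n * n) + (b * n + c) by rewrite mulnDl mulnA addnA.
have h1 i j : size (upto n (fun c => [:: val i j c])) = n.
  by rewrite (@size_upto _ n 1) ?muln1.
have h2 i : size (upto n (fun b => upto n (fun c => [:: val i b c]))) = n * n.
  exact: size_upto.
rewrite (@nth_upto _ 0 n (n * n)) //; last first.
  apply: leq_trans (_ : b.+1 * n <= _); rewrite ?leq_mul2r ?hb ?orbT //.
  by rewrite mulSn addnC ltn_add2r.
rewrite (@nth_upto _ 0 n n) // -[c]addn0 -[c in LHS]muln1.
by rewrite (@nth_upto _ 0 n 1) // addn0.
Qed.

(* A literal occurrence is named by the head position [q] of the separator
   before it, so that its encoding is a prefix of [drop q x]. *)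
Definition stepb (x : seq nat) (q q' : nat) : bool :=
  [&& q < q', sym x q' == 2 &
      all (fun k => (q < k) ==> (sym x k < 2)) (iota 0 q')].

(** [q1] is the end of the preceding clause, which reads 3, or the left endmarker, which reads 4. *)
Definition clauseb (x : seq nat) (q1 q2 q3 : nat) : bool :=
  [&& 2 < sym x q1, stepb x q1 q2 & stepb x q2 q3].

(** [p] precedes a negative and [q] a positive literal, and [l] is the common length of their binary
    indices. Digits are compared by cases, since an atomic condition of the comprehension tests a
    single symbol. *)
Definition conflictb (x : seq nat) (p q : nat) : bool :=
  [&& sym x (p + 1) == 0, sym x (q + 1) == 1 &
      has (fun l => [&& sym x (p + l + 2) == 2, sym x (q + l + 2) == 2 &
             all (fun k => ((sym x (p + k + 2) == 0) && (sym x (q + k + 2) == 0))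
                        || ((sym x (p + k + 2) == 1) && (sym x (q + k + 2) == 1)))
               (iota 0 l)])
        (iota 0 (size x).+3)].

(** * The algebra of an input word *)

Section Instance.
Variable x : seq nat.
Let n := (size x).+3.
Let b := (size x).+1.
Let bot := (size x).+2.

(* As a function of [x] and [y], [val_jonsson x y y] is the meet of the flat
   semilattice with bottom [bot]. *)
Definition val_jonsson (x1 x2 x3 : nat) : nat :=
  if x2 == x3 then (if x1 == x2 then x1 else bot) else x1.

Definition val_clause (q1 q2 q3 x1 x2 x3 : nat) : nat :=
  if (x1 == x2) && (x2 == x3) then x1
  else if [&& x1 == bot, x2 == b & x3 == b] then q1
  else if [&& x1 == b, x2 == bot & x3 == b] then q2
  else if [&& x1 == b, x2 == b & x3 == bot] then q3
  else bot.

Definition val_conflict (p q x1 x2 x3 : nat) : nat :=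
  if x1 == x2 then x1
  else if (x1 == p) && (x2 == b) then b
  else if (x1 == b) && (x2 == q) then b
  else bot.

Definition inst_ops : seq (nat * seq nat) :=
  op3 n val_jonsson ::
  upto n (fun q1 => upto n (fun q2 => upto n (fun q3 =>
    if clauseb x q1 q2 q3 then [:: op3 n (val_clause q1 q2 q3)] else [::])))
  ++ upto n (fun p => upto n (fun q =>
    if conflictb x p q then [:: op3 n (val_conflict p q)] else [::])).

Definition inst : alg := Alg n inst_ops.

Lemma jonsson_in_ops : op3 n val_jonsson \in inst_ops.
Proof. exact: mem_head. Qed.

Lemma clause_in_ops q1 q2 q3 : q1 < n -> q2 < n -> q3 < n -> clauseb x q1 q2 q3 ->
  op3 n (val_clause q1 q2 q3) \in inst_ops.
Proof.
move=> h1 h2 h3 hc; rewrite inE mem_cat; apply/orP; right; apply/orP; left.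
apply/uptoP; exists q1 => //; apply/uptoP; exists q2 => //; apply/uptoP.
by exists q3 => //; rewrite hc mem_head.
Qed.

Lemma conflict_in_ops p q : p < n -> q < n -> conflictb x p q ->
  op3 n (val_conflict p q) \in inst_ops.
Proof.
move=> hp hq hc; rewrite inE mem_cat; apply/orP; right; apply/orP; right.
apply/uptoP; exists p => //; apply/uptoP; exists q => //.
by rewrite hc mem_head.
Qed.

Variant inst_ops_spec : nat * seq nat -> Prop :=
| OpJonsson : inst_ops_spec (op3 n val_jonsson)
| OpClause q1 q2 q3 of q1 < n & q2 < n & q3 < n & clauseb x q1 q2 q3 :
    inst_ops_spec (op3 n (val_clause q1 q2 q3))
| OpConflict p q of p < n & q < n & conflictb x p q :
    inst_ops_spec (op3 n (val_conflict p q)).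

Lemma inst_opsP o : o \in inst_ops -> inst_ops_spec o.
Proof.
rewrite inE mem_cat => /or3P[/eqP ->| |]; first exact: OpJonsson.
  case/uptoP=> q1 h1 /uptoP[q2 h2 /uptoP[q3 h3]].
  by case: ifP => // hc; rewrite inE => /eqP ->; apply: OpClause.
case/uptoP=> p hp /uptoP[q hq].
by case: ifP => // hc; rewrite inE => /eqP ->; apply: OpConflict.
Qed.

Lemma inst_op3 o : o \in inst_ops -> exists2 val, o = op3 n val &
  (forall a, val a a a = a) /\
  forall a1 a2 a3, a1 < n -> a2 < n -> a3 < n -> val a1 a2 a3 < n.
Proof.
case/inst_opsP => [|q1 q2 q3 h1 h2 h3 _|p q hp hq _]; eexists; try by [];
  split=> [a|a1 a2 a3 ha1 ha2 ha3].
- by rewrite /val_jonsson !eqxx.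
- by rewrite /val_jonsson; case: ifP => //; case: ifP.
- by rewrite /val_clause !eqxx.
- by rewrite /val_clause; do !case: ifP => //.
- by rewrite /val_conflict !eqxx.
- by rewrite /val_conflict; do !case: ifP => //.
Qed.

Lemma inst_wf : wf_alg inst.
Proof.
split=> // o /inst_op3 [val -> [_ hb]]; split; first exact: size_table.
apply/allP => v /uptoP[a1 h1 /uptoP[a2 h2 /uptoP[a3 h3]]].
by rewrite inE => /eqP ->; apply: hb.
Qed.

Lemma inst_idempotent : idempotent_alg inst.
Proof.
by move=> o /inst_op3 [val -> [hi _]] a ha; rewrite [nseq _ _]/= app_op3 ?hi.
Qed.

(** The chain is the first projection, [d], its mirror image and the third projection. The middle
    link [d(x,y,y) = d(y,x,x)] is the commutativity of the meet. *)
Lemma inst_jonsson : directed_jonsson inst.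
Proof.
pose d := op3 n val_jonsson.
exists [:: (fun x1 _ _ => x1); (fun x1 x2 x3 => app inst d [:: x1; x2; x3]);
           (fun x1 x2 x3 => app inst d [:: x3; x2; x1]); (fun _ _ x3 => x3)].
have p0 := @T_proj inst 0 isT; have p1 := @T_proj inst 1 isT.
have p2 := @T_proj inst 2 isT.
split=> //; split=> [g|/= x1 x2 x3 h1 h2 h3].
  case=> [<-|[<-|[<-|[<-|[]]]]]; [exact: p0 | | | exact: p2].
    apply: (@T_app inst d [:: _; _; _] jonsson_in_ops erefl) => g'.
    by case=> [<-|[<-|[<-|[]]]]; [exact: p0 | exact: p1 | exact: p2].
  apply: (@T_app inst d [:: _; _; _] jonsson_in_ops erefl) => g'.
  by case=> [<-|[<-|[<-|[]]]]; [exact: p2 | exact: p1 | exact: p0].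
split=> // [[|[|[|//]]] _|[|[|[|[|//]]]] _] //=;
  rewrite ?app_op3 // /val_jonsson ?eqxx //.
- by case: eqP.
- by rewrite eq_sym; case: eqP => [->|].
- by case: eqP => // ->.
- by case: eqP => // ->; rewrite eqxx.
- by case: eqP => // ->; rewrite eqxx.
Qed.

(** * Blockers and selections of literal occurrences *)

Definition selection (C : pred nat) : Prop :=
  (forall q1 q2 q3, q1 < n -> q2 < n -> q3 < n -> clauseb x q1 q2 q3 ->
    [|| C q1, C q2 | C q3]) /\
  (forall p q, p < n -> q < n -> conflictb x p q -> ~~ (C p && C q)).

(* Closure of [D^3 \ (D \ C)^3] forces each ternary operation to preserve [C]
   along some coordinate. *)
Lemma blocker_coordinate C D val c1 c2 c3 y1 z1 x2 z2 x3 y3 :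
  blocker inst b C D -> op3 n val \in inst_ops ->
  C c1 -> C c2 -> C c3 -> D y1 -> D z1 -> D x2 -> D z2 -> D x3 -> D y3 ->
  [|| C (val c1 y1 z1), C (val x2 c2 z2) | C (val x3 y3 c3)].
Proof.
move=> [[hDn _] [_ hCD] _ _ /(_ 3 isT) [_ hcl]] hop hc1 hc2 hc3 hy1 hz1 hx2 hz2 hx3 hy3.
(* Each of the three triples has its element of [C] in a coordinate of its own; the operation,
   applied coordinatewise, must give an element of [C] somewhere. *)
have := hcl _ hop [:: [:: c1; x2; x3]; [:: y1; c2; y3]; [:: z1; z2; c3]] erefl.
have [hd1 hd2 hd3] := And3 (hCD _ hc1) (hCD _ hc2) (hCD _ hc3).
rewrite /= hc1 hc2 hc3 hy1 hz1 hx2 hz2 hx3 hy3 hd1 hd2 hd3 /= !orbT => /(_ isT).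
by rewrite !app_op3 ?hDn // orbF => /andP[].
Qed.

Lemma blocker_selection : has_blocker inst b -> exists C, selection C.
Proof.
case=> C [D hbl]; exists C.
have [_ [[c hc] hCD] hCb hDb _] := hbl.
have hcb : c != b by apply: contraNneq hCb => <-.
(* The first coordinate gives the meet of [c] and [b], which is [bot]; the other two give [b], which
   is outside [C]. *)
have hCbot : C bot.
  have := blocker_coordinate hbl jonsson_in_ops hc hc hc hDb hDb hDb hDb hDb hDb.
  rewrite /val_jonsson !eqxx (negbTE hcb) (negbTE hCb) eq_sym (negbTE hcb).
  by rewrite (negbTE hCb) !orbF.
have hbb : (bot == b) = false by apply/eqP; rewrite /bot /b; lia.
have hbb' : (b == bot) = false by rewrite eq_sym.
split=> [q1 q2 q3 h1 h2 h3 hcl|p q hp hq hcf].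
  (* With [bot] on the diagonal and [b] elsewhere, the three values are [q1], [q2], [q3]. *)
  have := blocker_coordinate hbl (clause_in_ops h1 h2 h3 hcl)
    hCbot hCbot hCbot hDb hDb hDb hDb hDb hDb.
  by rewrite /val_clause !eqxx hbb hbb'.
apply/negP => /andP[hCp hCq].
(* With [p], [q] and again [p] on the diagonal and [b] elsewhere, all three values are [b], outside
   [C]. *)
have := blocker_coordinate hbl (conflict_in_ops hp hq hcf)
  hCp hCq hCp hDb hDb hDb hDb hDb hDb.
have hval u w : val_conflict p q p b w = b /\ val_conflict p q b q u = b
    /\ val_conflict p q b b w = b.
  rewrite /val_conflict !eqxx !andbT; split; first by case: eqP.
  by split=> //; case: eqP => // _; case: ifP.
have [-> _] := hval b b; have [_ [-> _]] := hval b b; have [_ [_ ->]] := hval b p.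
by rewrite (negbTE hCb).
Qed.

(** The blocker is [C] with [bot] added, inside the whole universe. If an operation preserves this
    set along an argument place, the tuple in that place has an entry in the set, and the result has
    one at the same position. *)
Lemma selection_blocker C : selection C -> (forall q, C q -> q <= size x) ->
  has_blocker inst b.
Proof.
move=> [hcl hcf] hC; pose C' q := (q == bot) || C q.
have hCn q : C' q -> q < n by case/orP => [/eqP ->|/hC] //; rewrite /n; lia.
have hCb : ~~ C' b.
  rewrite /C' negb_or; apply/andP; split; first by rewrite /b /bot; lia.
  by apply/negP => /hC; rewrite ltnn.
have hCbot : C' bot by rewrite /C' eqxx.
have nb a : C' a -> (a == b) = false.
  by move=> ha; apply/eqP => h; rewrite h (negbTE hCb) in ha.
have hcoord o : o \in inst_ops -> exists val, o = op3 n val /\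
    [\/ forall a1 a2 a3, C' a1 -> C' (val a1 a2 a3),
        forall a1 a2 a3, C' a2 -> C' (val a1 a2 a3) |
        forall a1 a2 a3, C' a3 -> C' (val a1 a2 a3)].
  case/inst_opsP => [|q1 q2 q3 h1 h2 h3 h|p q hp hq h]; eexists; split; try by [].
  - by apply: Or31 => a1 a2 a3 h; rewrite /val_jonsson; do !case: ifP.
  (* An argument in [C'] differs from [b], which excludes the branches that return the other two
     literals; the value is that argument, the selected literal or [bot]. *)
  - case/or3P: (hcl _ _ _ h1 h2 h3 h) => hq; [apply: Or31|apply: Or32|apply: Or33];
      move=> a1 a2 a3 ha; rewrite /val_clause ?(nb _ ha) ?andbF ?andFb /=.
    + by do !case: ifP => // _; rewrite /C' hq orbT.
    + by case: ifP => [/andP[/eqP -> _]//|_]; do !case: ifP => // _; rewrite /C' hq orbT.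
    + case: ifP => [/andP[/eqP -> /eqP ->]//|_]; do !case: ifP => // _.
      by rewrite /C' hq orbT.
  (* As [bot] lies in [C'], it must be told apart from [p] and [q]: the position after [bot] is
     beyond the word and reads neither 0 nor 1. *)
  have [hpb hqb] : (p == bot) = false /\ (q == bot) = false.
    by case/and3P: h => /eqP h1 /eqP h2 _; split; apply/eqP => e;
      [move: h1 | move: h2]; rewrite e /sym /bot addn1 /= ltnS leqW ?leqnn ?leqnSn.
  (* If [p] is selected, [q] is not, and an entry of [C'] in the second place is neither [b] nor
     [q]; otherwise an entry of [C'] in the first place is neither [b] nor [p]. *)
  case: (boolP (C p)) (hcf _ _ hp hq h) => /= hCp hCq.
    apply: Or32 => a1 a2 a3 ha; rewrite /val_conflict (nb _ ha) andbF.
    case: ifP => [/eqP -> //|_]; case: ifP => // /andP[_ /eqP ea].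
    by move: ha; rewrite /C' ea hqb (negbTE hCq).
  apply: Or31 => a1 a2 a3 ha; rewrite /val_conflict (nb _ ha) /=.
  case: ifP => // _; case: ifP => // /andP[/eqP ea _].
  by move: ha; rewrite /C' ea hpb (negbTE hCp).
exists C', (fun q => q < n); split=> //.
- split=> // o /inst_op3 [val -> [_ hb]] [|a1 [|a2 [|a3 [|]]]] //= _.
  by case/and4P=> h1 h2 h3 _; rewrite app_op3 ?hb.
- by split=> //; exists bot.
move=> m m_gt0; split=> [t /andP[/andP[/eqP -> ht] _] //|o ho ts].
have [val [e hval]] := hcoord _ ho.
case: ts => [|t1 [|t2 [|t3 [|]]]] //=; rewrite e //= => _.
case/and4P=> /andP[/andP[/eqP s1 d1] c1] /andP[/andP[/eqP s2 d2] c2]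
  /andP[/andP[/eqP s3 d3] c3] _.
have hD t j : size t = m -> all (fun q => q < n) t -> j < m -> nth 0 t j < n.
  by move=> <- /allP ht hj; apply: ht; rewrite mem_nth.
have happ j : j < m -> app inst (op3 n val) [:: nth 0 t1 j; nth 0 t2 j; nth 0 t3 j]
    = val (nth 0 t1 j) (nth 0 t2 j) (nth 0 t3 j).
  by move=> hj; rewrite app_op3 ?hD.
have hhas t : size t = m -> has C' t -> exists2 j, j < m & C' (nth 0 t j).
  by move=> ht /(has_nthP 0)[j]; rewrite ht; exists j.
rewrite size_map size_iota eqxx /=; apply/andP; split.
  rewrite all_map; apply/allP => j; rewrite mem_iota => /= hj; rewrite happ //.
  have [val' e' [_ hb]] := inst_op3 ho.
  by rewrite -happ // -e e' app_op3 ?hb ?hD.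
rewrite has_map; apply/hasP.
have [j hj hCj] : exists2 j, j < m & C' (val (nth 0 t1 j) (nth 0 t2 j) (nth 0 t3 j)).
  case: hval => h; [have [j hj hCj] := hhas _ s1 c1 | have [j hj hCj] := hhas _ s2 c2 |
    have [j hj hCj] := hhas _ s3 c3]; exists j => //; exact: h.
by exists j; rewrite ?mem_iota //= happ.
Qed.

End Instance.

(** * Formulas as words *)

Definition bits (u : seq nat) : bool := all (fun a => a < 2) u.

Lemma bits_bin m : bits (bin m).
Proof.
elim/ltn_ind: m => -[|m] // IH; rewrite bin_half // /bits all_rcons.
by rewrite -/(bits _) IH ?andbT; lia.
Qed.

Lemma bin_inj : injective bin.
Proof.
pose value := foldl (fun a d => a * 2 + d) 0.
suff binK : cancel bin value by exact: can_inj binK.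
elim/ltn_ind=> -[|m] // IH; rewrite bin_half // /value -cats1 foldl_cat /=.
by rewrite -/(value _) IH; lia.
Qed.

Lemma bits_cat2_inj u w r s : bits u -> bits w -> u ++ 2 :: r = w ++ 2 :: s ->
  u = w /\ r = s.
Proof.
elim: u w => [|a u IH] [|c w] //=.
- by move=> _ _ [->].
- by move=> _ /andP[hc _] [ec]; rewrite -ec in hc.
- by move=> /andP[ha _] _ [ea]; rewrite ea in ha.
by move=> /andP[_ hu] /andP[_ hw] [-> /(IH _ hu hw)[-> ->]].
Qed.

(** Head position [h.+1] scans index [h], and the default 4 stands for the endmarker. *)
Lemma symS x h : sym x h.+1 = nth 4 x h.
Proof.
rewrite /sym /= ltnS; case: (leqP (size x) h) => hh; first by rewrite nth_default.
exact: set_nth_default.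
Qed.

Lemma nth4_size (x : seq nat) h a : nth 4 x h = a -> a < 4 -> h < size x.
Proof. by move=> <-; case: (ltnP h (size x)) => // hh; rewrite nth_default. Qed.

Lemma stepb_drop x q q' : stepb x q q' ->
  exists2 u, bits u & drop q x = u ++ 2 :: drop q' x.
Proof.
case: q' => [|h] /and3P[hq]; first by rewrite ltn0 in hq.
rewrite symS => /eqP hh hall; have hs := nth4_size hh isT.
exists (take (h - q) (drop q x)).
  apply/(all_nthP 4) => i; rewrite size_take size_drop ltn_min => /andP[hi _].
  rewrite nth_take // nth_drop -symS.
  have /(allP hall) : (q + i).+1 \in iota 0 h.+1 by rewrite mem_iota; lia.
  by rewrite ltnS leq_addr.
rewrite -{1}[drop q x](cat_take_drop (h - q)) drop_drop subnK //.
by rewrite (drop_nth 4 hs) hh.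
Qed.

Lemma drop_stepb x q u r : bits u -> drop q x = u ++ 2 :: r ->
  stepb x q (q + size u).+1 /\ drop (q + size u).+1 x = r.
Proof.
move=> hu hx; have hnth i : nth 4 x (q + i) = nth 4 (u ++ 2 :: r) i.
  by rewrite -hx nth_drop.
split; last by rewrite -addnS addnC -drop_drop hx -cat_rcons drop_size_cat ?size_rcons.
rewrite /stepb symS hnth nth_cat ltnn subnn ltnS leq_addr eqxx /=.
apply/allP => k; rewrite mem_iota => /andP[_ hk]; apply/implyP => hqk.
have [i ek] : exists i, k = (q + i).+1 by exists (k - q.+1); lia.
have hi : i < size u by lia.
by rewrite ek symS hnth nth_cat hi; apply: (allP hu); rewrite mem_nth.
Qed.

Definition enc_lit (l : bool * nat) : seq nat := nat_of_bool l.1 :: bin l.2.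

Definition enc_clause (cl : seq (bool * nat)) : seq nat :=
  flatten [seq enc_lit l ++ [:: 2] | l <- cl] ++ [:: 3].

Lemma enc_formulaE psi : enc_formula psi = flatten [seq enc_clause cl | cl <- psi].
Proof. by []. Qed.

Lemma enc_formula_cat psi1 psi2 :
  enc_formula (psi1 ++ psi2) = enc_formula psi1 ++ enc_formula psi2.
Proof. by rewrite !enc_formulaE map_cat flatten_cat. Qed.

Lemma enc_formula_cons cl psi :
  enc_formula (cl :: psi) = enc_clause cl ++ enc_formula psi.
Proof. by []. Qed.

Lemma bits_enc_lit l : bits (enc_lit l).
Proof. by rewrite /= bits_bin andbT; case: l.1. Qed.

Lemma enc_lits_small cl : all (fun a => a < 3) (flatten [seq enc_lit l ++ [:: 2] | l <- cl]).
Proof.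
elim: cl => // l cl IH.
rewrite -[flatten _]/((enc_lit l ++ [:: 2]) ++ flatten [seq enc_lit l ++ [:: 2] | l <- cl]).
rewrite all_cat IH andbT all_cat andbT.
by apply: sub_all (bits_enc_lit l) => a; apply: ltnW.
Qed.

Lemma enc_formula_small psi : all (fun a => a < 4) (enc_formula psi).
Proof.
elim: psi => // cl psi IH; rewrite enc_formula_cons !all_cat IH /= andbT.
by rewrite andbT; apply: sub_all (enc_lits_small _) => a; apply: ltnW.
Qed.

(** A symbol above 2 occurs only at the end of a clause, so a prefix ending in one consists of whole
    clauses. The default 3 of [last] admits the empty prefix. *)
Lemma enc_formula_start psi w1 w2 : enc_formula psi = w1 ++ w2 ->
  2 < last 3 w1 -> exists psi1 psi2, psi = psi1 ++ psi2 /\ w2 = enc_formula psi2.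
Proof.
elim: psi w1 => [|cl psi IH] w1.
  by case: w1 => //; case: w2 => // _ _; exists [::], [::].
case: w1 => [/= <- _|a w1]; first by exists [::], (cl :: psi).
rewrite enc_formula_cons /enc_clause; set body := flatten _ => e hlast.
have hbody : all (fun a => a < 3) body by exact: enc_lits_small.
(* A nonempty prefix inside the body of the first clause would end in a symbol below 3. *)
have [hle|hgt] := leqP (size (a :: w1)) (size body).
  have hw : a :: w1 = take (size (a :: w1)) body.
    have := congr1 (take (size (a :: w1))) e.
    by rewrite -catA takel_cat // take_size_cat.
  have : last 3 (a :: w1) \in body.
    have hl : last 3 (a :: w1) \in a :: w1 := mem_last a w1.
    by rewrite -[body](cat_take_drop (size (a :: w1))) mem_cat -hw hl.
  by move/(allP hbody); rewrite ltnNge hlast.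
have hb3 : size (body ++ [:: 3]) <= size (a :: w1) by rewrite size_cat addn1.
have ew : a :: w1 = (body ++ [:: 3]) ++ drop (size (body ++ [:: 3])) (a :: w1).
  rewrite -{1}[a :: w1](cat_take_drop (size (body ++ [:: 3]))); congr (_ ++ _).
  have := congr1 (take (size (body ++ [:: 3]))) e.
  by rewrite take_size_cat // takel_cat.
set w := drop _ _ in ew; rewrite ew -[RHS]catA in e.
have [] := IH w.
- by have := congr1 (drop (size (body ++ [:: 3]))) e; rewrite !drop_size_cat.
- by move: hlast; rewrite ew -catA last_cat /= ; case: (w).
by move=> psi1 [psi2 [-> ->]]; exists (cl :: psi1), psi2.
Qed.

(** * Literal occurrences, clauses and conflicts *)

Definition lit_at (x : seq nat) (q : nat) (l : bool * nat) : bool :=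
  prefix (enc_lit l ++ [:: 2]) (drop q x).

Lemma lit_atP x q l :
  reflect (exists r, drop q x = enc_lit l ++ 2 :: r) (lit_at x q l).
Proof.
by rewrite /lit_at; apply: (iffP (@prefixP _ _ _)) => -[r ->]; exists r; rewrite -?catA.
Qed.

Lemma lit_at_size x q l : lit_at x q l -> q < size x.
Proof.
case/lit_atP => r h; rewrite ltnNge; apply/negP => hq.
by move: h; rewrite drop_oversize.
Qed.

Lemma conflictb_lit_at x p q l l' : lit_at x p l -> lit_at x q l' ->
  conflictb x p q = [&& ~~ l.1, l'.1 & l.2 == l'.2].
Proof.
move=> hl hl'; have hp := lit_at_size hl; have hq := lit_at_size hl'.
case/lit_atP: hl => r hr; case/lit_atP: hl' => r' hr'.
have hnp i : sym x (p + i + 1) = nth 4 (enc_lit l ++ 2 :: r) i.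
  by rewrite addn1 symS -nth_drop hr.
have hnq i : sym x (q + i + 1) = nth 4 (enc_lit l' ++ 2 :: r') i.
  by rewrite addn1 symS -nth_drop hr'.
have hnp2 i : sym x (p + i + 2) = nth 4 (bin l.2 ++ 2 :: r) i.
  by rewrite (_ : p + i + 2 = p + i.+1 + 1) ?hnp //; lia.
have hnq2 i : sym x (q + i + 2) = nth 4 (bin l'.2 ++ 2 :: r') i.
  by rewrite (_ : q + i + 2 = q + i.+1 + 1) ?hnq //; lia.
have := hnp 0; have := hnq 0; rewrite /conflictb !addn0 => -> ->.
rewrite ![nth _ (enc_lit _ ++ _) _]/=.
have -> : (nat_of_bool l.1 == 0) = ~~ l.1 by case: l.1.
have -> : (nat_of_bool l'.1 == 1) = l'.1 by case: l'.1.
congr [&& _, _ & _]; apply/hasP/eqP => [[i _]|e].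
  rewrite hnp2 hnq2 => /and3P[/eqP hi /eqP hi' /allP hall].
  have hk k : k < i -> nth 4 (bin l.2 ++ 2 :: r) k = nth 4 (bin l'.2 ++ 2 :: r') k
      /\ nth 4 (bin l.2 ++ 2 :: r) k < 2.
    move=> hki; have : k \in iota 0 i by rewrite mem_iota.
    by move/hall; rewrite hnp2 hnq2 => /orP[] /andP[/eqP -> /eqP ->].
  (* The first symbol that is not a bit stands right after the digits, so [i] is the length of both
     indices. *)
  have hsize j s : bits j -> nth 4 (j ++ 2 :: s) i = 2 ->
      (forall k, k < i -> nth 4 (j ++ 2 :: s) k < 2) -> size j = i.
    move=> hj hi2 hlt; case: (ltngtP (size j) i) => // hji.
      by have := hlt _ hji; rewrite nth_cat ltnn subnn.
    by move: hi2; rewrite nth_cat hji => e; have := allP hj _ (mem_nth 4 hji); rewrite e.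
  have s1 := hsize _ _ (bits_bin l.2) hi (fun k h => (hk k h).2).
  have s2 : size (bin l'.2) = i.
    by apply: (hsize _ _ (bits_bin l'.2) hi') => k h; rewrite -(hk k h).1 (hk k h).2.
  apply: bin_inj; apply: (@eq_from_nth _ 4); first by rewrite s1 s2.
  by move=> k; rewrite s1 => h; have := (hk k h).1; rewrite !nth_cat s1 s2 h.
exists (size (bin l.2)).
  have := congr1 size hr; rewrite size_drop size_cat mem_iota /=; lia.
rewrite hnp2 hnq2 -e !nth_cat ltnn subnn /=; apply/allP => k; rewrite mem_iota => /= hk.
rewrite hnp2 hnq2 -e !nth_cat hk.
by have := allP (bits_bin l.2) _ (mem_nth 4 hk); case: nth => [|[|]].
Qed.

Lemma clauseb_complete psi1 psi2 l1 l2 l3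
    (x := enc_formula (psi1 ++ [:: l1; l2; l3] :: psi2)) :
  exists q1 q2 q3, [/\ clauseb x q1 q2 q3, lit_at x q1 l1, lit_at x q2 l2 & lit_at x q3 l3].
Proof.
pose q1 := size (enc_formula psi1); pose s := 3 :: enc_formula psi2.
have h1 : drop q1 x = enc_lit l1 ++ 2 :: (enc_lit l2 ++ 2 :: (enc_lit l3 ++ 2 :: s)).
  rewrite /x enc_formula_cat drop_size_cat // enc_formula_cons /enc_clause.
  by rewrite /enc_lit; do 3!rewrite /= -?catA.
have [st1 h2] := drop_stepb (bits_enc_lit l1) h1.
have [st2 h3] := drop_stepb (bits_enc_lit l2) h2.
eexists q1; eexists; eexists; split.
- apply/and3P; split; [|exact: st1|exact: st2].
  (* For empty [psi1] the position is 0 and reads the left endmarker; otherwise it reads the 3 that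
     closes the last clause of [psi1]. *)
  rewrite /q1 /x; case/lastP: (psi1) => // phi cl.
  rewrite -cats1 !enc_formula_cat enc_formula_cons cats0 /enc_clause.
  by rewrite catA cats1 size_rcons symS cat_rcons nth_cat ltnn subnn.
- by apply/lit_atP; eexists; exact: h1.
- by apply/lit_atP; eexists; exact: h2.
- by apply/lit_atP; eexists; exact: h3.
Qed.

Lemma clauseb_sound psi q1 q2 q3 (x := enc_formula psi) : is3CNF psi -> clauseb x q1 q2 q3 ->
  exists l1 l2 l3, [/\ [:: l1; l2; l3] \in psi, lit_at x q1 l1,
    lit_at x q2 l2 & lit_at x q3 l3].
Proof.
move=> h3 /and3P[hq1 /stepb_drop[u1 hu1 e1] /stepb_drop[u2 hu2 e2]].
(* The right endmarker exceeds 2 as well, but no literal follows it. *)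
have hsz : q1 < size x.
  by rewrite ltnNge; apply/negP => hq; move: e1; rewrite drop_oversize //; case: u1 {hu1}.
have [||psi1 [psi2 [epsi e]]] := @enc_formula_start psi (take q1 x) (drop q1 x).
- by rewrite cat_take_drop.
- case: q1 hq1 hsz {e1} => [|h]; first by rewrite take0.
  by rewrite symS => hh hs; rewrite (take_nth 4) ?(ltnW hs) // last_rcons.
case: psi2 e epsi => [|cl psi2] e epsi; first by move: e1; rewrite e; case: u1 {hu1}.
have hcl : cl \in psi by rewrite epsi mem_cat mem_head orbT.
move: (allP h3 _ hcl) => hs3; case: cl hs3 hcl e {epsi} => [|l1 [|l2 [|l3 [|]]]] //= _ hcl e.
exists l1, l2, l3; pose s := 3 :: enc_formula psi2.
have d1 : drop q1 x = enc_lit l1 ++ 2 :: (enc_lit l2 ++ 2 :: (enc_lit l3 ++ 2 :: s)).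
  rewrite e enc_formula_cons /enc_clause.
  by rewrite /enc_lit; do 3!rewrite /= -?catA.
have [_ d2] := bits_cat2_inj hu1 (bits_enc_lit l1) (etrans (esym e1) d1).
have [_ d3] := bits_cat2_inj hu2 (bits_enc_lit l2) (etrans (esym e2) d2).
split=> //; apply/lit_atP; eexists; [exact: d1|exact: d2|exact: d3].
Qed.

(** * Selections and satisfying assignments *)

Lemma selection_sat psi C : is3CNF psi -> selection (enc_formula psi) C -> satisfiable psi.
Proof.
move=> h3 [hcl hcf]; set x := enc_formula psi in hcl hcf.
(* A variable is true when one of its positive occurrences is selected; a selected negative
   occurrence excludes this by the conflict condition. *)
exists (fun i => has (fun q => C q && lit_at x q (true, i)) (iota 0 (size x))).
have hlit l q : C q -> lit_at x q l ->
    has (fun q => C q && lit_at x q (true, l.2)) (iota 0 (size x)) == l.1.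
  case: l => [[] i] hC hl /=.
    by apply/eqP/hasP; exists q; rewrite ?hC // mem_iota (lit_at_size hl).
  rewrite eqbF_neg; apply/hasPn => q'; rewrite mem_iota => /= hq'.
  apply/negP => /andP[hC' hl']; have := hcf q q'; rewrite hC hC'.
  have hq := lit_at_size hl; rewrite (conflictb_lit_at hl hl') /= eqxx.
  by move=> h; suff: false by []; apply: h => //; move: hq'; rewrite add0n; lia.
apply/allP => cl hin; have hs := allP h3 _ hin.
have [psi1 [psi2 epsi]] : exists psi1 psi2, psi = psi1 ++ cl :: psi2.
  by case/splitPr: hin => psi1 psi2; exists psi1, psi2.
case: cl hs epsi {hin} => [|l1 [|l2 [|l3 [|]]]] // _ epsi.
have := clauseb_complete psi1 psi2 l1 l2 l3; rewrite -epsi -/x.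
case=> [q1 [q2 [q3 [hc a1 a2 a3]]]].
have hb q l : lit_at x q l -> q < (size x).+3.
  by move=> h; rewrite (leq_trans (lit_at_size h)) // !leqW.
have := hcl q1 q2 q3 (hb _ _ a1) (hb _ _ a2) (hb _ _ a3) hc.
case/or3P => hC; apply/hasP; [exists l1|exists l2|exists l3];
  rewrite ?inE ?eqxx ?orbT //.
- exact: hlit hC a1.
- exact: hlit hC a2.
- exact: hlit hC a3.
Qed.

Lemma sat_selection psi : is3CNF psi -> satisfiable psi ->
  exists2 C, selection (enc_formula psi) C & forall q, C q -> q <= size (enc_formula psi).
Proof.
move=> h3 [v hv]; set x := enc_formula psi.
(* The selection consists of all occurrences of literals that [v] makes true. *)
exists (fun q => has (fun l => (v l.2 == l.1) && lit_at x q l) (flatten psi)); last first.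
  by move=> q /hasP[l _ /andP[_ /lit_at_size /ltnW]].
split=> [q1 q2 q3 _ _ _ hc|p q _ _ hc].
  have [l1 [l2 [l3 [hin a1 a2 a3]]]] := clauseb_sound h3 hc.
  have hf l : l \in [:: l1; l2; l3] -> l \in flatten psi.
    by move=> hl; apply/flattenP; exists [:: l1; l2; l3].
  have := allP hv _ hin; rewrite /= orbF => /or3P[] h; apply/or3P.
  - by apply: Or31; apply/hasP; exists l1; rewrite ?h ?hf ?inE ?eqxx.
  - by apply: Or32; apply/hasP; exists l2; rewrite ?h ?hf ?inE ?eqxx ?orbT.
  - by apply: Or33; apply/hasP; exists l3; rewrite ?h ?hf ?inE ?eqxx ?orbT.
apply/negP => /andP[/hasP[l _ /andP[/eqP h1 a1]] /hasP[l' _ /andP[/eqP h2 a2]]].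
move: hc; rewrite (conflictb_lit_at a1 a2) => /and3P[hl hl' /eqP e].
by rewrite -h1 e h2 hl' in hl.
Qed.

(** * The instance as a comprehension *)

Definition BEq v w := BIf (BNeq v w) (BConst false) (BConst true).
Definition BNot e := BIf e (BConst false) (BConst true).
Definition BAnd e1 e2 := BIf e1 e2 (BConst false).
Definition BOr e1 e2 := BIf e1 (BConst true) e2.
Definition BAll v e := BNot (BEx v (BNot e)).

(* [d] is the level of the first free variable. *)
Definition BLt d v w := BEx w (BEq d v).

Definition BStep d v w :=
  BAnd (BLt d v w) (BAnd (BSym [:: w] 0 (pred1 2))
    (BAll w (BOr (BNot (BLt d.+1 v d)) (BSym [:: d] 0 (fun a => a < 2))))).

Definition BClause :=
  BAnd (BSym [:: 3] 0 (fun a => 2 < a)) (BAnd (BStep 6 3 4) (BStep 6 4 5)).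

Definition BConflict :=
  BAnd (BSym [:: 3] 1 (pred1 0)) (BAnd (BSym [:: 4] 1 (pred1 1))
    (BEx 2 (BAnd (BSym [:: 3; 5] 2 (pred1 2)) (BAnd (BSym [:: 4; 5] 2 (pred1 2))
      (BAll 5 (BOr
        (BAnd (BSym [:: 3; 6] 2 (pred1 0)) (BSym [:: 4; 6] 2 (pred1 0)))
        (BAnd (BSym [:: 3; 6] 2 (pred1 1)) (BSym [:: 4; 6] 2 (pred1 1))))))))).

(* The variables 0, 1, 2 hold the element [b], the bottom element and the
   cardinal. *)
Definition GJonsson :=
  GIf (BEq 4 5) (GIf (BEq 3 4) (GPrint 3) (GPrint 1)) (GPrint 3).

Definition GClause :=
  GIf (BAnd (BEq 6 7) (BEq 7 8)) (GPrint 6)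
  (GIf (BAnd (BEq 6 1) (BAnd (BEq 7 0) (BEq 8 0))) (GPrint 3)
  (GIf (BAnd (BEq 6 0) (BAnd (BEq 7 1) (BEq 8 0))) (GPrint 4)
  (GIf (BAnd (BEq 6 0) (BAnd (BEq 7 0) (BEq 8 1))) (GPrint 5)
  (GPrint 1)))).

Definition GConflict :=
  GIf (BEq 5 6) (GPrint 5)
  (GIf (BAnd (BEq 5 3) (BEq 6 0)) (GPrint 0)
  (GIf (BAnd (BEq 5 0) (BEq 6 4)) (GPrint 0)
  (GPrint 1))).

(** The leading digits 1, 1 are the arity 3 in binary. *)
Definition GTable (v : gen) : gen :=
  GSeq (GSeq (GOut 1) (GSeq (GOut 1) (GOut 2)))
    (GSeq (GFor 2 (GFor 2 (GFor 2 (GSeq v (GOut 2))))) (GOut 3)).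

Definition GInstance : gen :=
  GSeq (GPrint 2) (GSeq (GOut 3) (GSeq (GPrint 0) (GSeq (GOut 3)
  (GSeq (GTable GJonsson)
  (GSeq (GFor 2 (GFor 2 (GFor 2 (GIf BClause (GTable GClause) GNil))))
        (GFor 2 (GFor 2 (GIf BConflict (GTable GConflict) GNil)))))))).

(** * The comprehension evaluates to the encoded instance *)

Section Semantics.
Variable x : seq nat.

Lemma bsem_eq env v w : bsem x env (BEq v w) = (nth 0 env v == nth 0 env w).
Proof. by rewrite /=; case: eqP. Qed.

Lemma bsem_and env e1 e2 : bsem x env (BAnd e1 e2) = bsem x env e1 && bsem x env e2.
Proof. by []. Qed.

Lemma bsem_or env e1 e2 : bsem x env (BOr e1 e2) = bsem x env e1 || bsem x env e2.
Proof. by []. Qed.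

Lemma bsem_not env e : bsem x env (BNot e) = ~~ bsem x env e.
Proof. by rewrite /=; case: bsem. Qed.

Lemma bsem_ex env v e : bsem x env (BEx v e) =
  has (fun i => bsem x (rcons env i) e) (iota 0 (nth 0 env v)).
Proof. by []. Qed.

Lemma bsem_all env v e : bsem x env (BAll v e) =
  all (fun i => bsem x (rcons env i) e) (iota 0 (nth 0 env v)).
Proof.
by rewrite bsem_not -[all _ _]negbK -has_predC; congr negb; apply: eq_has.
Qed.

Lemma bsem_lt env d v w : size env = d -> v < d ->
  bsem x env (BLt d v w) = (nth 0 env v < nth 0 env w).
Proof.
move=> hd hv; rewrite [LHS](_ : _ = has (pred1 (nth 0 env v)) (iota 0 (nth 0 env w))).
  by rewrite has_pred1 mem_iota.
by rewrite bsem_ex; apply: eq_has => i; rewrite bsem_eq !nth_rcons hd hv ltnn eqxx.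
Qed.

Lemma bsem_sym1 env v k f : bsem x env (BSym [:: v] k f) = f (sym x (nth 0 env v + k)).
Proof. by rewrite /= addn0. Qed.

Lemma bsem_sym2 env v w k f :
  bsem x env (BSym [:: v; w] k f) = f (sym x (nth 0 env v + nth 0 env w + k)).
Proof. by rewrite /= addn0. Qed.

Lemma bsem_step env d v w : size env = d -> v < d -> w < d ->
  bsem x env (BStep d v w) = stepb x (nth 0 env v) (nth 0 env w).
Proof.
move=> hd hv hw; rewrite !bsem_and bsem_lt // bsem_sym1 addn0 bsem_all /stepb.
congr [&& _, _ & _]; apply: eq_all => k.
rewrite bsem_or bsem_not bsem_lt ?size_rcons ?hd //.
  by rewrite bsem_sym1 addn0 !nth_rcons hd hv ltnn eqxx implybE.
exact: leqW.
Qed.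

Lemma bsem_clause b0 b1 b2 q1 q2 q3 :
  bsem x [:: b0; b1; b2; q1; q2; q3] BClause = clauseb x q1 q2 q3.
Proof. by rewrite bsem_and bsem_sym1 addn0 bsem_and !bsem_step. Qed.

(** The third entry bounds the search for the common length, hence its fixed value. *)
Lemma bsem_conflict b0 b1 p q :
  bsem x [:: b0; b1; (size x).+3; p; q] BConflict = conflictb x p q.
Proof.
rewrite !bsem_and !bsem_sym1 /conflictb; rewrite bsem_ex.
congr [&& _, _ & _]; apply: eq_has => l.
rewrite !bsem_and !bsem_sym2 bsem_all; congr [&& _, _ & _]; apply: eq_all => k.
by rewrite bsem_or !bsem_and !bsem_sym2.
Qed.

Definition enc_op (o : nat * seq nat) : seq nat :=
  bin o.1 ++ [:: 2] ++ flatten [seq bin e ++ [:: 2] | e <- o.2] ++ [:: 3].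

Lemma flatten_map_upto S T (h : S -> seq T) n F :
  flatten [seq h y | y <- upto n F] = upto n (fun i => flatten [seq h y | y <- F i]).
Proof. by rewrite /upto; elim: (iota 0 n) => //= i s IH; rewrite map_cat flatten_cat IH. Qed.

Lemma eq_upto T n (F G : nat -> seq T) : F =1 G -> upto n F = upto n G.
Proof. by move=> h; rewrite /upto (eq_map h). Qed.

Lemma gsem_for env v g :
  gsem x env (GFor v g) = upto (nth 0 env v) (fun i => gsem x (rcons env i) g).
Proof. by []. Qed.

Lemma gsem_table env v val n : 2 < size env -> nth 0 env 2 = n ->
  (forall a b c, gsem x (rcons (rcons (rcons env a) b) c) v = bin (val a b c)) ->
  gsem x env (GTable v) = enc_op (op3 n val).
Proof.
move=> hs hn hv; pose entry e := bin e ++ [:: 2].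
rewrite -[LHS]/([:: 1; 1; 2] ++ gsem x env (GFor 2 (GFor 2 (GFor 2 (GSeq v (GOut 2)))))
  ++ [:: 3]).
rewrite -[RHS]/([:: 1; 1; 2] ++ flatten [seq entry e | e <- table n val] ++ [:: 3]).
congr (_ ++ (_ ++ _)).
rewrite gsem_for hn flatten_map_upto; apply: eq_upto => a.
rewrite gsem_for nth_rcons hs hn flatten_map_upto; apply: eq_upto => b.
rewrite gsem_for !nth_rcons size_rcons leqW // hs hn flatten_map_upto.
by apply: eq_upto => c; rewrite /= hv cats0.
Qed.

Lemma gsem_jonsson a b c :
  gsem x [:: (size x).+1; (size x).+2; (size x).+3; a; b; c] GJonsson
  = bin (val_jonsson x a b c).
Proof. by rewrite /val_jonsson /=; do !case: (_ == _). Qed.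

Lemma gsem_clause q1 q2 q3 a b c :
  gsem x [:: (size x).+1; (size x).+2; (size x).+3; q1; q2; q3; a; b; c] GClause
  = bin (val_clause x q1 q2 q3 a b c).
Proof. by rewrite /val_clause /=; do !case: (_ == _). Qed.

Lemma gsem_conflict p q a b c :
  gsem x [:: (size x).+1; (size x).+2; (size x).+3; p; q; a; b; c] GConflict
  = bin (val_conflict x p q a b c).
Proof. by rewrite /val_conflict /=; do !case: (_ == _). Qed.

Lemma gsem_instance :
  gsem x [:: (size x).+1; (size x).+2; (size x).+3] GInstance
  = enc_instance (inst x, (size x).+1).
Proof.
set env := [:: _; _; _]; pose n := (size x).+3.
rewrite /enc_instance -[flatten _]/(flatten [seq enc_op o | o <- inst_ops x]).
rewrite -[LHS]/(bin n ++ [:: 3] ++ bin (size x).+1 ++ [:: 3] ++ gsem x env (GTable GJonsson)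
  ++ gsem x env (GFor 2 (GFor 2 (GFor 2 (GIf BClause (GTable GClause) GNil))))
  ++ gsem x env (GFor 2 (GFor 2 (GIf BConflict (GTable GConflict) GNil)))).
congr (_ ++ (_ ++ (_ ++ (_ ++ _)))).
rewrite /inst_ops map_cons map_cat -cat1s flatten_cat flatten_cat [flatten [:: _]]cats0.
congr (_ ++ (_ ++ _)).
- by apply: gsem_table => // a b c; apply: gsem_jonsson.
- rewrite gsem_for flatten_map_upto; apply: eq_upto => q1.
  rewrite gsem_for flatten_map_upto; apply: eq_upto => q2.
  rewrite gsem_for flatten_map_upto; apply: eq_upto => q3.
  rewrite -[LHS]/(if bsem x [:: (size x).+1; (size x).+2; n; q1; q2; q3] BClause then
    gsem x [:: (size x).+1; (size x).+2; n; q1; q2; q3] (GTable GClause) else [::]).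
  rewrite bsem_clause; case: ifP => // _; rewrite [RHS]cats0.
  by apply: gsem_table => // a b c; apply: gsem_clause.
rewrite gsem_for flatten_map_upto; apply: eq_upto => p.
rewrite gsem_for flatten_map_upto; apply: eq_upto => q.
rewrite -[LHS]/(if bsem x [:: (size x).+1; (size x).+2; n; p; q] BConflict then
  gsem x [:: (size x).+1; (size x).+2; n; p; q] (GTable GConflict) else [::]).
rewrite bsem_conflict; case: ifP => // _; rewrite [RHS]cats0.
by apply: gsem_table => // a b c; apply: gsem_conflict.
Qed.

End Semantics.

(** * The reduction from 3-SAT *)

Theorem theorem4p7 :
  exists f : formula -> alg * nat,
    logspace_computable enc_formula enc_instance is3CNF f /\
    forall psi, is3CNF psi ->
      [/\ wf_alg (f psi).1, (f psi).2 < acard (f psi).1,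
          idempotent_alg (f psi).1, directed_jonsson (f psi).1 &
          (satisfiable psi <-> has_blocker (f psi).1 (f psi).2)].
Proof.
exists (fun psi => (inst (enc_formula psi), (size (enc_formula psi)).+1)); split.
  have [|M [c [hM hrun]]] := @gen_logspace GInstance; first by [].
  exists M, c; split=> // psi _; rewrite -gsem_instance; apply: hrun.
  exact: enc_formula_small.
move=> psi h3; split.
- exact: inst_wf.
- exact: leqnSn.
- exact: inst_idempotent.
- exact: inst_jonsson.
split=> [/(sat_selection h3)[C hsel hC]|/blocker_selection[C hsel]].
  exact: selection_blocker hsel hC.
exact: selection_sat h3 hsel.
Qed.
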